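(* Let $N\ge 2$ and $1^\ast=\frac{N}{N-1}$. The imbedding $\dot{BV}(\mathbb{R}^N)\hookrightarrow L^{1^\ast,1}(\mathbb{R}^N)$ is not cocompact with respect to the group $\mathcal{D}=\{g[j,y] : j\in\mathbb{Z},\,y\in\mathbb{R}^N\}$, where $g[j,y]u=2^{(N-1)j}u(2^j(\cdot-y))$. That is, there exists a sequence $\{u_n\}\subset\dot{BV}(\mathbb{R}^N)$ such that $g[j_n,y_n]u_n\rightharpoonup 0$ in $\dot{BV}(\mathbb{R}^N)$ for every sequence $\{(j_n,y_n)\}\subset\mathbb{Z}\times\mathbb{R}^N$, but $u_n$ does not converge to $0$ in $L^{1^\ast,1}(\mathbb{R}^N)$.
   Context: $\dot{BV}(\mathbb{R}^N)$ is the space of all measurable functions $u$ on $\mathbb{R}^N$ (locally integrable, identified when equal a.e.) that vanish at infinity, i.e. $|\{x\in\mathbb{R}^N : |u(x)|>M\}|<\infty$ for every $M>0$ (where $|A|$ is Lebesgue measure), and satisfy $$\|u\|_{\dot{BV}}=\|Du\|=\sup\Big\{\int_{\mathbb{R}^N}u\,\mathrm{div}\,v\,dx : v\in C_0^\infty(\mathbb{R}^N;\mathbb{R}^N),\ \|v\|_\infty\le 1\Big\}<\infty,$$ with $\|v\|_\infty=\sup_x\big(\sum_{i=1}^N v_i(x)^2\big)^{1/2}$; $C_0^\infty$ means smooth with compact support. Weak convergence $u_n\rightharpoonup u$ in $\dot{BV}(\mathbb{R}^N)$ means: $u_n\to u$ in $L^1_{loc}(\mathbb{R}^N)$, and for each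 $1\le i\le N$ the distributional derivatives satisfy $\partial_i u_n\rightharpoonup\partial_i u$ weakly as finite measures on $\mathbb{R}^N$, i.e. weak-* in $(C_0(\mathbb{R}^N))^\ast$, where $C_0(\mathbb{R}^N)$ denotes continuous functions tending to $0$ at infinity. Lorentz space: for measurable $u$ let $\mu(\lambda)=|\{x : |u(x)|>\lambda\}|$ and $u^\ast(t)=\sup\{\lambda>0 : \mu(\lambda)>t\}$ (with $\sup\emptyset=0$). For $q<\infty$, $L^{p,q}(\mathbb{R}^N)$ is the set of measurable $u$ with finite quasinorm $\|u\|_{L^{p,q}}=\big(\int_0^\infty (u^\ast(t)t^{1/p})^q\frac{dt}{t}\big)^{1/q}$. Convergence in $L^{p,q}$ is with respect to this quasinorm. *)

(* Defs.v *)
From HB Require Import structures.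
From mathcomp Require Import all_boot all_order all_algebra.
From mathcomp Require Import all_classical all_reals all_analysis.

Set Implicit Arguments.
Unset Strict Implicit.
Unset Printing Implicit Defensive.

Import Order.TTheory GRing.Theory Num.Theory.
Import numFieldNormedType.Exports.

Local Open Scope classical_set_scope.
Local Open Scope ring_scope.

(* R^n is 'rV[R]_n. Its sigma-algebra is generated by the coordinate maps, as
   the library does for n.-tuple; since R is second countable this is the Borel
   sigma-algebra. *)
Definition measure_rV_display : measure_display -> measure_display.
Proof. exact. Qed.

Section measurable_rV.
Context {d} {T : measurableType d}.
Variable n : nat.

Let coors : 'I_n -> 'rV[T]_n -> T := fun i x => x ord0 i.

Let rV_set0 : g_sigma_preimage coors set0.
Proof. exact: sigma_algebra0. Qed.

Let rV_setC A : g_sigma_preimage coors A -> g_sigma_preimage coors (~` A).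
Proof. exact: sigma_algebraC. Qed.

Let rV_bigcup (F : _^nat) : (forall i, g_sigma_preimage coors (F i)) ->
  g_sigma_preimage coors (\bigcup_i (F i)).
Proof. exact: sigma_algebra_bigcup. Qed.

HB.instance Definition _ := @isMeasurable.Build (measure_rV_display d)
  'rV[T]_n (g_sigma_preimage coors) rV_set0 rV_setC rV_bigcup.

End measurable_rV.

Lemma measurable_coord d (T : measurableType d) n (i : 'I_n) :
  measurable_fun [set: 'rV[T]_n] (fun x => x ord0 i).
Proof.
move=> _ Y mY; rewrite setTI; apply: sub_sigma_algebra => /=.
rewrite -bigcup_seq/=; exists i => /=; first by rewrite mem_index_enum.
by exists Y => //; rewrite setTI.
Qed.

Lemma measurable_rVP d1 d2 (T1 : measurableType d1) (T2 : measurableType d2) n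
    (f : T1 -> 'rV[T2]_n) :
  (forall i, measurable_fun [set: T1] (fun t => f t ord0 i)) ->
  measurable_fun [set: T1] f.
Proof.
move=> mf _ A mA; rewrite setTI.
suff : g_sigma_preimage (fun i (x : 'rV[T2]_n) => x ord0 i) `<=`
    [set A | measurable (f @^-1` A)] by exact.
apply: smallest_sub.
  split => /=.
  - by rewrite preimage_set0.
  - by move=> B mB; rewrite setTD preimage_setC; exact: measurableC.
  - by move=> F mF; rewrite preimage_bigcup; exact: bigcupT_measurable.
rewrite -bigcup_seq => B [i _ [Y mY <-]] /=.
by rewrite setTI -[X in measurable X]setTI; exact: (mf i).
Qed.

Section lebesgue_rV.
Context {R : realType}.
Local Open Scope ereal_scope.

Definition consrV n (p : measurableTypeR R * 'rV[R]_n) : 'rV[R]_n.+1 :=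
  row_mx (const_mx p.1 : 'rV[R]_1) p.2.

Lemma consrV0 n p : @consrV n p ord0 ord0 = p.1.
Proof.
have E : row_mx (const_mx p.1 : 'rV[R]_1) p.2 ord0 (lshift n ord0) = p.1.
  by rewrite row_mxEl mxE.
by rewrite -[RHS]E; congr (row_mx _ _ _ _); exact: val_inj.
Qed.

Lemma consrV_lift n p (i : 'I_n) :
  @consrV n p ord0 (lift ord0 i) = p.2 ord0 i.
Proof.
rewrite -(row_mxEr (const_mx p.1 : 'rV[R]_1) p.2 ord0 i).
by congr (row_mx _ _ _ _); exact: val_inj.
Qed.

Lemma measurable_consrV n : measurable_fun setT (@consrV n).
Proof.
apply: measurable_rVP => i; case: (unliftP ord0 i) => [k|] ->.
  rewrite (_ : (fun _ => _) = (fun x : 'rV[R]_n => x ord0 k) \o snd).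
    exact: (measurableT_comp (@measurable_coord _ _ n k) measurable_snd).
  by apply/funext => p; exact: consrV_lift.
rewrite (_ : (fun _ => _) = fst); first exact: measurable_fst.
by apply/funext => p; exact: consrV0.
Qed.

(* Lebesgue measure on R^n, as the n-fold product of the one-dimensional one *)
Fixpoint lebesgue_rV (n : nat) : set 'rV[R]_n -> \bar R :=
  match n with
  | 0 => \d_(0%R : 'rV[R]_0)
  | m.+1 => pushforward (lebesgue_measure \x @lebesgue_rV m) (@consrV m)
  end.

Let uncons n (x : 'rV[R]_n.+1) : measurableTypeR R * 'rV[R]_n :=
  (x ord0 ord0, @rsubmx R 1 1 n x).

Let consrVK n : cancel (@consrV n) (@uncons n).
Proof.
by case=> a v; congr pair; [exact: consrV0|exact: (@row_mxKr R 1 1 n)].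
Qed.

Let measurable_uncons n : measurable_fun setT (@uncons n).
Proof.
apply/measurable_fun_pairP; split; first exact: measurable_coord.
apply: measurable_rVP => i; rewrite (_ : (fun _ => _) =
  (fun x : 'rV[R]_n.+1 => x ord0 (rshift 1 i))); first exact: measurable_coord.
by apply/funext => x; rewrite /= mxE.
Qed.

Let lebesgue_rV_ex n :
  exists mu : {sigma_finite_measure set 'rV[R]_n -> \bar R},
    mu = @lebesgue_rV n :> (set 'rV[R]_n -> \bar R).
Proof.
elim: n => [|n [mu IH]].
  by exists (\d_(0%R : 'rV[R]_0)).
pose m : {measure set (measurableTypeR R * 'rV[R]_n)%type -> \bar R} :=
  lebesgue_measure \x mu.
have LE : @lebesgue_rV n.+1 = pushforward m (@consrV n) by rewrite /= -IH.
have sf : sigma_finite setT (@lebesgue_rV n.+1).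
  have /sigma_finiteP[F [FT ndF Foo]] := sigma_finiteT (@lebesgue_measure R).
  have /sigma_finiteP[G [GT ndG Goo]] := sigma_finiteT mu.
  exists (fun k => @uncons n @^-1` (F k `*` G k)).
    rewrite -preimage_bigcup predeqE => x; split => // _.
    have : [set: measurableTypeR R] (@uncons n x).1 by [].
    have : [set: 'rV[R]_n] (@uncons n x).2 by [].
    rewrite FT GT => -[k _ Gk] [l _ Fl]; exists (maxn k l) => //; split.
    - by move: Fl; exact/subsetPset/ndF/leq_maxr.
    - by move: Gk; exact/subsetPset/ndG/leq_maxl.
  move=> k; have [? ?] := Foo k; have [? ?] := Goo k; split.
    rewrite -[X in measurable X]setTI; apply: measurable_uncons => //.
    exact: measurableX.
  rewrite LE /pushforward -comp_preimage (_ : _ \o _ = id) ?preimage_id.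
    by rewrite /m/= product_measure1E// lte_mul_pinfty// ge0_fin_numE.
  exact/funext/consrVK.
have h0 : lebesgue_rV (set0 : set 'rV[R]_n.+1) = 0.
  by rewrite LE /pushforward preimage_set0 measure0.
have hge0 (A : set 'rV[R]_n.+1) : 0 <= lebesgue_rV A.
  by rewrite LE /pushforward measure_ge0.
have hs : semi_sigma_additive (@lebesgue_rV n.+1).
  rewrite LE => B mB tB mUB; rewrite /pushforward preimage_bigcup.
  apply: measure_semi_sigma_additive.
  - by move=> k; rewrite -[X in measurable X]setTI; exact: measurable_consrV.
  - apply/trivIsetP => /= i j _ _ ij; rewrite -preimage_setI.
    by move/trivIsetP : tB => /(_ _ _ _ _ ij) ->//; rewrite preimage_set0.
  - rewrite -preimage_bigcup -[X in measurable X]setTI.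
    exact: measurable_consrV.
pose M := isMeasure.Build _ _ _ (@lebesgue_rV n.+1) h0 hge0 hs.
pose mu1 : {measure set 'rV[R]_n.+1 -> \bar R} :=
  HB.pack (@lebesgue_rV n.+1) M.
pose S := Measure_isSigmaFinite.Build _ _ _ mu1 sf.
pose mu' : {sigma_finite_measure set 'rV[R]_n.+1 -> \bar R} :=
  HB.pack (@lebesgue_rV n.+1) M S.
by exists mu'.
Qed.

Let lebesgue_rV0 n : @lebesgue_rV n set0 = 0.
Proof. by have [mu <-] := lebesgue_rV_ex n; exact: measure0. Qed.

Let lebesgue_rV_ge0 n A : 0 <= @lebesgue_rV n A.
Proof. by have [mu <-] := lebesgue_rV_ex n; exact: measure_ge0. Qed.

Let lebesgue_rV_semi_sigma_additive n : semi_sigma_additive (@lebesgue_rV n).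
Proof.
by have [mu <-] := lebesgue_rV_ex n; exact: measure_semi_sigma_additive.
Qed.

HB.instance Definition _ n := isMeasure.Build _ _ _ (@lebesgue_rV n)
  (@lebesgue_rV0 n) (@lebesgue_rV_ge0 n) (@lebesgue_rV_semi_sigma_additive n).

Let lebesgue_rV_sigma_finite n : sigma_finite setT (@lebesgue_rV n).
Proof. by have [mu <-] := lebesgue_rV_ex n; exact: sigma_finiteT. Qed.

HB.instance Definition _ n := Measure_isSigmaFinite.Build _ _ _
  (@lebesgue_rV n) (@lebesgue_rV_sigma_finite n).

Lemma lebesgue_rV_box n (A : 'I_n -> set (measurableTypeR R)) :
  (forall i, measurable (A i)) ->
  lebesgue_rV [set x : 'rV[R]_n | forall i, A i (x ord0 i)] =
  \prod_(i < n) lebesgue_measure (A i).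
Proof.
elim: n A => [A _|n IH A mA].
  rewrite big_ord0 /= diracE mem_set// => -[]//.
rewrite /= /pushforward (_ : _ @^-1` _ =
    A ord0 `*` [set x : 'rV[R]_n | forall i, A (lift ord0 i) (x ord0 i)]).
  rewrite product_measure1E//.
  - by rewrite big_ord_recl; congr (_ * _); exact: (IH (fun i => A (lift ord0 i))).
  - rewrite (_ : mkset _ = \bigcap_(i in [set: 'I_n])
        ((fun x : 'rV[R]_n => x ord0 i) @^-1` A (lift ord0 i))); last first.
      by apply/seteqP; split=> [x Ax i _|x Ax i]; [exact: Ax|exact: Ax].
    apply: fin_bigcap_measurable => // i _; rewrite -[X in measurable X]setTI.
    exact: (@measurable_coord _ R n i measurableT _ (mA (lift ord0 i))).
apply/seteqP; split => -[a v] /=.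
- move=> Ax; split; first by have := Ax ord0; rewrite consrV0.
  by move=> i; have := Ax (lift ord0 i); rewrite consrV_lift.
- by move=> [Aa Av] i; case: (unliftP ord0 i) => [k|] ->;
    rewrite ?consrV_lift ?consrV0.
Qed.

End lebesgue_rV.

Section test_functions.
Context {R : realType} {n : nat}.
Implicit Types (f phi : 'rV[R]_n -> R) (v : 'rV[R]_n -> 'rV[R]_n).

Definition partial (i : 'I_n) f : 'rV[R]_n -> R :=
  fun x => 'D_(delta_mx ord0 i) f x.

(* partial derivatives of all orders exist and are continuous *)
Definition smooth f := forall s : seq 'I_n,
  continuous (foldr partial f s) /\
  forall i x, derivable (foldr partial f s) x (delta_mx ord0 i).

(* C_0^oo(R^n) *)
Definition test_function phi :=
  smooth phi /\ compact (closure [set x | phi x != 0]).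

(* C_0^oo(R^n; R^n) *)
Definition test_field v := forall i, test_function (fun x => v x ord0 i).

Definition div v : 'rV[R]_n -> R :=
  fun x => \sum_(i < n) partial i (fun y => v y ord0 i) x.

(* The library's norm on 'rV[R]_n is the max norm. *)
Definition eucl_norm (x : 'rV[R]_n) : R :=
  Num.sqrt (\sum_(i < n) x ord0 i ^+ 2).

(* C_0(R^n): continuous functions tending to 0 at infinity *)
Definition C0_function phi := continuous phi /\
  forall e : R, 0 < e -> exists r : R, forall x, r < eucl_norm x -> `|phi x| < e.

End test_functions.

Section BV.
Context {R : realType} {n : nat}.
Local Open Scope ereal_scope.
Implicit Types u : 'rV[R]_n -> R.
Let mu : {measure set 'rV[R]_n -> \bar R} := @lebesgue_rV R n.

Definition locally_integrable_rV u := measurable_fun setT u /\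
  forall K : set 'rV[R]_n, compact K -> \int[mu]_(x in K) `|u x|%:E < +oo.

Definition vanishes_at_infinity u :=
  forall M : R, (0 < M)%R -> mu [set x | (M < `|u x|)%R] < +oo.

Definition total_variation u : \bar R :=
  ereal_sup [set \int[mu]_x (u x * div v x)%:E | v in
    [set v : 'rV[R]_n -> 'rV[R]_n |
      test_field v /\ forall x, (eucl_norm (v x) <= 1)%R]].

(* Functions stand for their classes modulo a.e. equality. *)
Definition BVdot u := [/\ locally_integrable_rV u, vanishes_at_infinity u
  & total_variation u < +oo].

Definition cvg_L1loc (u_ : nat -> 'rV[R]_n -> R) u :=
  forall K : set 'rV[R]_n, compact K ->
    (fun k => \int[mu]_(x in K) `|u_ k x - u x|%:E) @ \oo --> 0.

End BV.

(* Integral of f against a finite signed measure; by uniqueness of the Jordan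
   decomposition it does not depend on the chosen Hahn decomposition. *)
Definition charge_integral {R : realType} d (T : measurableType d)
    (nu : {charge set T -> \bar R}) (f : T -> R) : R :=
  let P := cid (Hahn_decomposition nu) in
  let N := cid (projT2 P) in
  \int[jordan_pos (projT2 N)]_x f x - \int[jordan_neg (projT2 N)]_x f x.

Section weak_convergence.
Context {R : realType} {n : nat}.
Implicit Types u : 'rV[R]_n -> R.

(* nu is the distributional derivative of u in direction i *)
Definition is_deriv_charge u (i : 'I_n)
    (nu : {charge set 'rV[R]_n -> \bar R}) :=
  forall phi, test_function phi ->
    charge_integral nu phi =
    - \int[@lebesgue_rV R n]_x (u x * partial i phi x).

(* weak-* convergence in the dual of C_0(R^n) *)
Definition charge_weak_cvg (nu_ : nat -> {charge set 'rV[R]_n -> \bar R})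
    (nu : {charge set 'rV[R]_n -> \bar R}) :=
  forall phi, C0_function phi ->
    (fun k => charge_integral (nu_ k) phi) @ \oo --> charge_integral nu phi.

Definition BVdot_weak_cvg (u_ : nat -> 'rV[R]_n -> R) u :=
  [/\ forall k, BVdot (u_ k), BVdot u, cvg_L1loc u_ u &
    forall i, exists nu_ nu,
      [/\ forall k, is_deriv_charge (u_ k) i (nu_ k),
          is_deriv_charge u i nu & charge_weak_cvg nu_ nu]].

(* g[j, y] u *)
Definition dilation (j : int) (y : 'rV[R]_n) u : 'rV[R]_n -> R :=
  fun x => 2 ^ (n.-1%:Z * j) * u (2 ^ j *: (x - y)).

End weak_convergence.

Section Lorentz.
Context {R : realType} {n : nat}.
Local Open Scope ereal_scope.
Implicit Types u : 'rV[R]_n -> R.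

Definition distribution_fun u (l : R) : \bar R :=
  @lebesgue_rV R n [set x | (l < `|u x|)%R].

(* adjoining 0 makes the supremum of the empty set 0 *)
Definition decr_rearrangement u (t : R) : \bar R :=
  ereal_sup (0 |` [set l%:E | l in
    [set l : R | (0 < l)%R /\ t%:E < distribution_fun u l]]).

Definition Lorentz_norm (p q : R) u : \bar R :=
  (\int[@lebesgue_measure R]_(t in `]0%R, +oo[)
     ((decr_rearrangement u t * (t `^ p^-1)%:E) `^ q * (t^-1)%:E)) `^ q^-1.

Definition Lorentz (p q : R) u :=
  measurable_fun setT u /\ Lorentz_norm p q u < +oo.

Definition Lorentz_cvg (p q : R) (u_ : nat -> 'rV[R]_n -> R) u :=
  (fun k => Lorentz_norm p q (fun x => u_ k x - u x)%R) @ \oo --> 0.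

End Lorentz.

(* Main.v *)
(* In dimension [n.+1], let [u k] be the average of the functions
   [2^(n i) 1_{[0, 2^-i]^n.+1}], [i <= k], i.e. of [k.+1] dyadic rescalings of
   the indicator of the unit cube. When [t] runs between the volumes of two
   consecutive cubes, the integral defining the [L^{1*,1}] norm is at least
   [1 / (4 k.+1)], so the [k.+1] scales together keep the norm above [1/4].
   Applying [g[j, y]] only shifts the scales and moves the cubes. Integrals over
   a compact set, as well as pairings of the derivative with a function of [C_0],
   are then averages over [k.+1] consecutive scales of a quantity that is bounded
   and small away from the unit scale, uniformly in the position of the cube:
   they tend to [0] whatever [j] and [y] are. The derivative of the indicator of
   a cube is explicit (the difference of the measures carried by two faces), so
   no density of test functions in [C_0] is needed. *)
Require Import Defs.
From mathcomp Require Import all_boot all_order all_algebra.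
From mathcomp Require Import all_classical all_reals all_analysis.
From mathcomp Require Import measurable_realfun zify lra ring.

Set Implicit Arguments.
Unset Strict Implicit.
Unset Printing Implicit Defensive.

Import Order.TTheory GRing.Theory Num.Theory.
Import numFieldNormedType.Exports.

Local Open Scope classical_set_scope.
Local Open Scope ring_scope.

(** * Borel sets and Fubini's theorem in R^n *)

Section borel_rV.
Context {R : realType} {n : nat}.

Definition box (A : 'I_n -> set R) : set 'rV[R]_n :=
  [set x | forall i, A i (x ord0 i)].

Lemma measurable_box (A : 'I_n -> set (measurableTypeR R)) :
  (forall i, measurable (A i)) -> measurable (box A : set 'rV[R]_n).
Proof.
move=> mA; rewrite (_ : box A = \bigcap_(i in [set: 'I_n])
  ((fun x : 'rV[R]_n => x ord0 i) @^-1` A i)); last first.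
  by apply/seteqP; split=> [x Ax i _|x Ax i]; exact: Ax.
apply: fin_bigcap_measurable => // i _; rewrite -[X in measurable X]setTI.
exact: (@measurable_coord _ R n i measurableT _ (mA i)).
Qed.

Lemma coord_le_norm (x : 'rV[R]_n) i : `|x ord0 i| <= `|x|.
Proof.
rewrite [leRHS]/Num.norm /= mx_normrE; apply/bigmax_geP; right => /=.
by exists (ord0, i).
Qed.

Lemma ball_rV_box (x : 'rV[R]_n) (e : R) : 0 < e ->
  ball x e = box (fun i => ball (x ord0 i) e).
Proof.
move=> e0; apply/seteqP; split => [y xy i|y xy]; first exact: (xy.2 ord0 i).
by split=> // i j; rewrite (ord1 i); exact: xy.
Qed.

(** The sigma-algebra is generated by the coordinates, not by the topology. Second countability
    links the two: an open set is the countable union of the boxes with rational centre and radius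
    that it contains. *)
Lemma open_rV_measurable (U : set 'rV[R]_n) : open U -> measurable U.
Proof.
move=> oU.
pose q2x (p : 'rV[rat]_n * rat) : set 'rV[R]_n :=
  box (fun i => ball (ratr (p.1 ord0 i) : R) (ratr p.2 : R)).
rewrite (_ : U = \bigcup_(p in [set p | q2x p `<=` U]) q2x p).
  rewrite bigcup_mkcond; apply: countable_bigcupT_measurable => // p.
  case: ifP => // _; apply: measurable_box => i.
  by rewrite ball_itv; exact: measurable_itv.
apply/seteqP; split => [x Ux|x [p pU px]]; last exact: pU.
have /nbhs_ballP[e/= e0 xeU] : nbhs x U by exact: open_nbhs_nbhs.
have [r] : exists r : rat, ratr r \in `]0, e / 2[%R.
  by apply: rat_in_itvoo; rewrite divr_gt0.
rewrite in_itv/= => /andP[r0 re].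
have H i : exists q : rat, `|x ord0 i - ratr q| < ratr r :> R.
  have [q] := @rat_in_itvoo R (x ord0 i - ratr r) (x ord0 i + ratr r) ltac:(lra).
  rewrite in_itv/= => /andP[q1 q2]; exists q.
  by rewrite ltr_norml; lra.
have {H}[q qP] := choice H.
exists (\row_i q i, r).
  move=> y yq; apply: xeU; rewrite ball_rV_box// => i.
  have := yq i; rewrite /= mxE /ball/= => yqi.
  have := qP i => xqi.
  rewrite (le_lt_trans (ler_distD (ratr (q i)) _ _))//.
  by lra.
by move=> i; rewrite /= mxE /ball/= distrC.
Qed.

Lemma closed_rV_measurable (U : set 'rV[R]_n) : closed U -> measurable U.
Proof.
move=> cU; rewrite -[U]setCK; apply: measurableC.
by apply: open_rV_measurable; exact: closed_openC.
Qed.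

Lemma compact_rV_measurable (K : set 'rV[R]_n) : compact K -> measurable K.
Proof. by move=> /(compact_closed (@norm_hausdorff _ _))/closed_rV_measurable. Qed.

Lemma continuous_rV_measurable (f : 'rV[R]_n -> R) :
  continuous f -> measurable_fun setT f.
Proof.
move=> cf; apply: (measurability _ (measurable_realfun.RGenOpens.measurableE R)).
move=> _ [_ [a [b ->]] <-]; rewrite setTI.
apply: open_rV_measurable; move/continuousP: cf; apply; exact: interval_open.
Qed.

End borel_rV.

Section insert_coordinate.
Context {R : realType} {n : nat}.
Implicit Types (i : 'I_n.+1) (p : measurableTypeR R * 'rV[R]_n).

(** [lebesgue_rV] is built by adding a coordinate in front, as in [consrV], whereas a derivative in
    direction [i] calls for integrating coordinate [i] first; hence this variant at an arbitrary
    position. *)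
Definition insert i p : 'rV[R]_n.+1 :=
  \row_j if unlift i j is Some k then p.2 ord0 k else p.1.

Lemma insert_same i p : insert i p ord0 i = p.1.
Proof. by rewrite mxE unlift_none. Qed.

Lemma insert_lift i p k : insert i p ord0 (lift i k) = p.2 ord0 k.
Proof. by rewrite mxE liftK. Qed.

Lemma measurable_insert i : measurable_fun setT (insert i).
Proof.
apply: measurable_rVP => j; case: (unliftP i j) => [k|] ->.
  rewrite (_ : (fun _ => _) = (fun x : 'rV[R]_n => x ord0 k) \o snd).
    exact: (measurableT_comp (@measurable_coord _ _ n k) measurable_snd).
  by apply/funext => p; exact: insert_lift.
rewrite (_ : (fun _ => _) = fst); first exact: measurable_fst.
by apply/funext => p; exact: insert_same.
Qed.

Lemma insert_box i p (A : 'I_n.+1 -> set R) :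
  box A (insert i p) <-> A i p.1 /\ box (fun k => A (lift i k)) p.2.
Proof.
split=> [Ap|[Ai Ap] j].
  split; first by have := Ap i; rewrite insert_same.
  by move=> k; have := Ap (lift i k); rewrite insert_lift.
by case: (unliftP i j) => [k|] ->; rewrite ?insert_lift ?insert_same.
Qed.

End insert_coordinate.

Section lebesgue_insert.
Context {R : realType}.
Local Open Scope ereal_scope.

Definition measurable_boxes n : set (set 'rV[R]_n) :=
  [set box A | A in [set A : 'I_n -> set (measurableTypeR R) |
    forall i, measurable (A i)]].

Lemma measurable_rV_box n :
  @measurable _ 'rV[R]_n = <<s @measurable_boxes n >>.
Proof.
apply/seteqP; split; last first.
  apply: smallest_sub; first exact: sigma_algebra_measurable.
  by move=> _ [A mA <-]; exact: measurable_box.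
apply: smallest_sub; first exact: smallest_sigma_algebra.
rewrite -bigcup_seq => B [i _ [Y mY <-]]; apply: sub_sigma_algebra.
exists (fun j => if j == i then Y else setT).
  by move=> j; case: ifP.
rewrite setTI; apply/seteqP; split => x /=.
  by move=> /(_ i); rewrite eqxx.
by move=> Yx j; case: ifPn => // /eqP ->.
Qed.

Lemma lebesgue_box n (A : 'I_n -> set (measurableTypeR R)) :
  (forall i, measurable (A i)) ->
  lebesgue_rV (box A) = \prod_(i < n) lebesgue_measure (A i).
Proof. exact: lebesgue_rV_box. Qed.

(** Both measures give a box the product of the lengths of its sides. Boxes form a generating class
    stable under intersection, and the cubes [[-k, k]^n.+1] exhaust the space with finite measure,
    so uniqueness of measures applies. *)
Lemma lebesgue_rV_insert n (i : 'I_n.+1) (A : set 'rV[R]_n.+1) : measurable A ->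
  lebesgue_rV A = pushforward (lebesgue_measure \x @lebesgue_rV R n) (insert i) A.
Proof.
move=> mA.
pose m2 := measure_function_pushforward__canonical__measure_function_Measure
  (lebesgue_measure \x @lebesgue_rV R n) (measurable_insert i).
apply: (measure_unique (@measurable_boxes n.+1)
  (fun k => box (fun=> `[(- k%:R)%R, k%:R]%classic)) _ _ _ _
  (@lebesgue_rV R n.+1) m2) => {A mA} //.
- exact: measurable_rV_box.
- move=> _ _ [A mA <-] [B mB <-]; exists (fun j => A j `&` B j).
    by move=> j; exact: measurableI.
  apply/seteqP; split => [x ABx|x [Ax Bx] j]; last by split; [exact: Ax|exact: Bx].
  by split => j; have [] := ABx j.
- by move=> k; eexists => // j; exact: measurable_itv.
- apply/seteqP; split => // x _; exists (Num.truncn (`|x|)%R).+1 => // j /=.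
  rewrite in_itv/= -ler_norml.
  by rewrite (le_trans (coord_le_norm _ _))// ltW// truncnS_gt.
- move=> _ [B mB <-]; rewrite [LHS](_ : _ = lebesgue_rV (box B))// (lebesgue_box mB).
  rewrite /m2/= /pushforward.
  rewrite (_ : _ @^-1` _ = B i `*` box (fun k => B (lift i k))); last first.
    by apply/seteqP; split => [p|p] /= /insert_box.
  rewrite product_measure1E//; last exact: measurable_box.
  rewrite (bigD1_ord i)//=; congr (_ * _); apply/esym.
  exact: (lebesgue_box (fun k => mB (lift i k))).
- move=> k.
  suff : lebesgue_rV (box (fun _ : 'I_n.+1 =>
    `[(- k%:R)%R, k%:R : R]%classic)) < +oo by [].
  rewrite lebesgue_box//.
  rewrite -ge0_fin_numE; last by apply: prode_ge0 => j _; exact: measure_ge0.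
  apply: (big_ind (fun x => x \is a fin_num)) => // [x y|j _].
    exact: fin_numM.
  rewrite ge0_fin_numE//.
  by rewrite lebesgue_measure_itv; case: ifP => // _; rewrite ltry.
Qed.

End lebesgue_insert.

(** * The divergence theorem on a cube *)

Section cube.
Context {R : realType} {n : nat}.
Implicit Types (l : R) (y : 'rV[R]_n).

Definition cube l y : set 'rV[R]_n :=
  box (fun i => `[y ord0 i, y ord0 i + l]%classic).

Lemma measurable_cube l y : measurable (cube l y).
Proof. by apply: measurable_box => i; exact: measurable_itv. Qed.

Lemma compact_cube l y : compact (cube l y).
Proof. by apply: rV_compact => i; exact: segment_compact. Qed.

Lemma lebesgue_cube l y : 0 <= l -> lebesgue_rV (cube l y) = (l ^+ n)%:E.
Proof.
move=> l0; rewrite lebesgue_box//.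
rewrite (eq_bigr (fun=> l%:E)) => [|i _].
  by rewrite prodEFin prodr_const card_ord.
rewrite lebesgue_measure_itv/= lte_fin ltrDl -EFinD addrAC subrr add0r.
by have [->|ln0] := eqVneq l 0; [rewrite ltxx|rewrite lt_def ln0 l0].
Qed.

Lemma continuous_integrable_cube (f : 'rV[R]_n -> R) l y : 0 <= l ->
  continuous f -> (@lebesgue_rV R n).-integrable (cube l y) (EFin \o f).
Proof.
move=> l0 cf; apply: measurable_bounded_integrable.
- exact: measurable_cube.
- by rewrite [ltLHS]lebesgue_cube// ltry.
- by apply: measurable_funTS; exact: continuous_rV_measurable.
- have /compact_bounded : compact (f @` cube l y).
    by apply: continuous_compact; [exact: continuous_subspaceT|exact: compact_cube].
  move=> [M [Mr fM]]; exists M; split => // t /fM {}fM x/= yx.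
  by apply: fM; exists x.
Qed.

End cube.

Section fubini_insert.
Context {R : realType} {n : nat}.
Variable i : 'I_n.+1.
Implicit Types (f : 'rV[R]_n.+1 -> \bar R) (y : 'rV[R]_n.+1).
Let mu := @lebesgue_measure R.
Local Open Scope ereal_scope.

(** Fubini's theorem with coordinate [i] innermost, ready for the fundamental theorem of
    calculus. *)
Lemma integral_insert f : (@lebesgue_rV R n.+1).-integrable setT f ->
  \int[@lebesgue_rV R n.+1]_x f x =
  \int[@lebesgue_rV R n]_v \int[mu]_t f (insert i (t, v)).
Proof.
move=> fi; have mf := measurable_int _ fi.
pose m2 := measure_function_pushforward__canonical__measure_function_Measure
  (mu \x @lebesgue_rV R n) (measurable_insert i).
have E (g : 'rV[R]_n.+1 -> \bar R) :
    \int[@lebesgue_rV R n.+1]_x g x = \int[m2]_x g x.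
  by apply: eq_measure_integral => A mA _; exact: (lebesgue_rV_insert i mA).
have mfi : measurable_fun setT (f \o insert i).
  by apply: measurableT_comp => //; exact: measurable_insert.
have fii : (mu \x @lebesgue_rV R n).-integrable setT (f \o insert i).
  apply/integrableP; split => //.
  move/integrableP : (fi) => [_]; rewrite E.
  rewrite ge0_integral_pushforward//; last exact: measurableT_comp.
  exact: measurable_insert.
rewrite E (integral_pushforward (measurable_insert i))//.
by rewrite -(integral21_prod_meas1 fii).
Qed.

Lemma integral_insert_cube (g : 'rV[R]_n.+1 -> R) l y : (0 <= l)%R ->
  continuous g ->
  \int[@lebesgue_rV R n.+1]_(x in cube l y) (g x)%:E =
  \int[@lebesgue_rV R n]_(v in cube l (col' i y))
    \int[mu]_(t in `[y ord0 i, (y ord0 i + l)%R]) (g (insert i (t, v)))%:E.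
Proof.
move=> l0 cg; rewrite integral_mkcond integral_insert; last first.
  apply: (integrable_mkcond _ (measurable_cube l y)).1.
  exact: continuous_integrable_cube.
rewrite [RHS]integral_mkcond; apply: eq_integral => v _.
rewrite [RHS]patchE; case: ifPn => [/set_mem vy|/negP vy].
  rewrite [RHS]integral_mkcond; apply: eq_integral => t _.
  rewrite !patchE; congr (if _ then _ else _).
  apply/idP/idP => /set_mem.
    by move=> /insert_box[ty _]; exact/mem_set.
  move=> ty; apply/mem_set/insert_box; split => // k; have := vy k.
  by rewrite /= mxE.
rewrite integral0_eq// => t _; rewrite patchE ifF//.
apply/negP => /set_mem/insert_box[_]/= yv; apply: vy; apply/mem_set => k.
by have := yv k; rewrite mxE.
Qed.

End fubini_insert.

Section partial_cube.
Context {R : realType} {n : nat}.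
Variable i : 'I_n.+1.
Implicit Types (f : 'rV[R]_n.+1 -> R) (v : 'rV[R]_n).
Let mu := @lebesgue_measure R.

Lemma insertD t h v :
  insert i (t + h, v) = h *: delta_mx ord0 i + insert i (t, v) :> 'rV[R]_n.+1.
Proof.
apply/rowP => j; rewrite !mxE eqxx/=; case: (unliftP i j) => [k ->|->].
  by rewrite eq_sym (negbTE (neq_lift _ _)) mulr0 add0r.
by rewrite eqxx mulr1 addrC.
Qed.

Lemma continuous_insert v : continuous (fun t => insert i (t, v) : 'rV[R]_n.+1).
Proof.
move=> t; rewrite (_ : (fun t => _) =
  (fun t => t *: delta_mx ord0 i + insert i (0, v))); last first.
  by apply/funext => s; rewrite -insertD add0r.
by apply: cvgD; [exact: scalel_continuous|exact: cvg_cst].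
Qed.

(** Difference quotients along the [i]-th basis vector are those of a one-variable section;
    rewriting with this transfers both derivability and the value of the derivative. *)
Let shift_insert f v t : (fun h : R => h^-1 *: ((f \o shift (insert i (t, v)))
    (h *: delta_mx ord0 i) - f (insert i (t, v)))) =
  (fun h : R => h^-1 *: (((fun s => f (insert i (s, v))) \o shift t) (h *: 1) -
    f (insert i (t, v)))).
Proof.
apply/funext => h /=; congr (_ *: (f _ - _)).
by rewrite -insertD [h *: 1]mulr1 addrC.
Qed.

Lemma integral_partial_itv f v a l : 0 < l -> continuous f ->
  (forall x, derivable f x (delta_mx ord0 i)) -> continuous (partial i f) ->
  (\int[mu]_(t in `[a, (a + l)%R]) (partial i f (insert i (t, v)))%:E =
   (f (insert i (a + l, v)) - f (insert i (a, v)))%:E)%E.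
Proof.
move=> l0 cf df cdf; rewrite (continuous_FTC2 (F := fun t => f (insert i (t, v)))).
- by rewrite EFinB.
- by rewrite ltrDl.
- apply: continuous_subspaceT => t; apply: continuous_comp; last exact: cdf.
  exact: continuous_insert.
- have cF : continuous (fun t => f (insert i (t, v))).
    by move=> t; apply: continuous_comp; [exact: continuous_insert|exact: cf].
  split.
  + by move=> t _; have := df (insert i (t, v)); rewrite /derivable shift_insert.
  + exact/cvg_at_right_filter/cF.
  + exact/cvg_at_left_filter/cF.
- by move=> t _; rewrite derive1E /partial /derive shift_insert.
Qed.

(** Each segment parallel to the [i]-th axis contributes the difference of the values at its ends,
    which lie on opposite faces. *)
Lemma integral_partial_cube f y l : 0 < l -> continuous f ->
  (forall x, derivable f x (delta_mx ord0 i)) -> continuous (partial i f) ->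
  (\int[@lebesgue_rV R n.+1]_(x in cube l y) (partial i f x)%:E =
   \int[@lebesgue_rV R n]_(v in cube l (col' i y))
     (f (insert i (y ord0 i + l, v)) - f (insert i (y ord0 i, v)))%:E)%E.
Proof.
move=> l0 cf df cdf; rewrite (integral_insert_cube i)// ?ltW//.
by apply: eq_integral => v _; rewrite integral_partial_itv.
Qed.

End partial_cube.

(** * Signed measures *)

Section signed_integral.
Context d {T : measurableType d} {R : realType}.
Implicit Types (m : {measure set T -> \bar R}) (f : T -> R)
  (L : (T -> R) -> R).

Lemma bounded_integrable m f : (m setT < +oo)%E -> measurable_fun setT f ->
  (exists M : R, forall x, `|f x| <= M) -> m.-integrable setT (EFin \o f).
Proof.
move=> mT mf [M fM]; apply: measurable_bounded_integrable => //.
exists M; split; first exact: num_real.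
by move=> N MN x _ /=; rewrite (le_trans (fM x))// ltW.
Qed.

Lemma integral_mscale m (c : {nonneg R}) f : m.-integrable setT (EFin \o f) ->
  (\int[mscale c m]_x (f x)%:E = c%:num%:E * \int[m]_x (f x)%:E)%E.
Proof.
move=> fi; have mf := measurable_int _ fi.
rewrite [LHS]integralE !ge0_integral_mscale//;
  [|exact: measurable_funeneg|exact: measurable_funepos].
rewrite -muleBr//; first by congr (_ * _)%E; rewrite [RHS]integralE.
by rewrite fin_num_adde_defl// fin_numN integrable_neg_fin_num.
Qed.

Lemma Rintegral_measure_add m1 m2 f : m1.-integrable setT (EFin \o f) ->
  m2.-integrable setT (EFin \o f) ->
  \int[measure_add m1 m2]_x f x = \int[m1]_x f x + \int[m2]_x f x.
Proof.
move=> f1 f2; rewrite /Rintegral integral_measure_add//.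
  by apply: fineD; exact: integrable_fin_num.
Qed.

Lemma Rintegral_mscale m (c : {nonneg R}) f : m.-integrable setT (EFin \o f) ->
  \int[mscale c m]_x f x = c%:num * \int[m]_x f x.
Proof.
move=> fi; rewrite /Rintegral integral_mscale//.
by apply: fineM => //; exact: integrable_fin_num.
Qed.

(* Keeping the two measures apart makes sums of such functionals immediate,
   whereas [charge_integral] involves a Hahn decomposition of the charge. *)
Definition signed_integral L := exists m1 m2,
  [/\ (m1 setT < +oo)%E, (m2 setT < +oo)%E &
   forall f, measurable_fun setT f -> (exists M : R, forall x, `|f x| <= M) ->
     L f = \int[m1]_x f x - \int[m2]_x f x].

Lemma signed_integral0 : signed_integral (fun=> 0).
Proof.
exists mzero, mzero; split; rewrite ?/mzero ?ltry//.
by move=> f mf bf; rewrite subrr.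
Qed.

Lemma signed_integralD L1 L2 : signed_integral L1 -> signed_integral L2 ->
  signed_integral (fun f => L1 f + L2 f).
Proof.
move=> [m1 [m2 [m1f m2f H]]] [m1' [m2' [m1f' m2f' H']]].
exists (measure_add m1 m1'), (measure_add m2 m2'); split.
- by rewrite [ltLHS](measure_addE m1 m1') lte_add_pinfty.
- by rewrite [ltLHS](measure_addE m2 m2') lte_add_pinfty.
move=> f mf bf; rewrite H// H'//.
have i1 := bounded_integrable m1f mf bf.
have i2 := bounded_integrable m2f mf bf.
have i1' := bounded_integrable m1f' mf bf.
have i2' := bounded_integrable m2f' mf bf.
rewrite !Rintegral_measure_add//.
by ring.
Qed.

Lemma signed_integralZ (c : R) L : 0 <= c -> signed_integral L ->
  signed_integral (fun f => c * L f).
Proof.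
move=> c0 [m1 [m2 [m1f m2f H]]].
exists (mscale (NngNum c0) m1), (mscale (NngNum c0) m2); split.
- by rewrite /= /mscale/= lte_mul_pinfty.
- by rewrite /= /mscale/= lte_mul_pinfty.
move=> f mf bf; rewrite H//.
have i1 := bounded_integrable m1f mf bf.
have i2 := bounded_integrable m2f mf bf.
rewrite !Rintegral_mscale//=.
by rewrite mulrBr.
Qed.

Lemma signed_integral_sum (I : Type) (s : seq I) (L : I -> (T -> R) -> R) :
  (forall i, signed_integral (L i)) ->
  signed_integral (fun f => \sum_(i <- s) L i f).
Proof.
move=> HL; elim: s => [|i s IH].
  rewrite (_ : (fun f => _) = fun=> 0); first exact: signed_integral0.
  by apply/funext => f; rewrite big_nil.
rewrite (_ : (fun f => _) = fun f => L i f + \sum_(i <- s) L i f).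
  exact: signed_integralD.
by apply/funext => f; rewrite big_cons.
Qed.

(** The charge is [m1 - m2]. Its Jordan parts need not be [m1] and [m2], but [jp + m2 = jn + m1] as
    measures; integrating [f] against both sides and rearranging gives the claim. *)
Lemma signed_integral_charge L : signed_integral L ->
  exists nu : {charge set T -> \bar R}, forall f, measurable_fun setT f ->
    (exists M : R, forall x, `|f x| <= M) -> charge_integral nu f = L f.
Proof.
have alg (a b c e : R) : a + b = c + e -> a - c = e - b by lra.
move=> [m1 [m2 [m1f m2f H]]].
have fin m : (m setT < +oo)%E -> fin_num_fun m.
  by move=> mT; apply: lty_fin_num_fun.
(* Restricting to the whole space packs the bound on the total mass into a finite measure, from
   which a charge can be made. *)
pose nu := cadd (charge_of_finite_measure (mfrestr measurableT m1f))
  (cscale (-1) (charge_of_finite_measure (mfrestr measurableT m2f))).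
exists nu => f mf bf; rewrite H// /charge_integral.
set P := cid _; set N := cid _; set nuPN := projT2 N.
set jp := jordan_pos _; set jn := jordan_neg _.
have jpn A : measurable A -> measure_add jp m2 A = measure_add jn m1 A.
  move=> mA; rewrite !measure_addE.
  suff : (jp A + m2 A = jn A + m1 A)%E by [].
  have nuE : nu A = (m1 (A `&` setT) - m2 (A `&` setT))%E.
    by rewrite -[in RHS]mulN1e.
  have : (m1 A - m2 A = jp A - jn A)%E.
    have := etrans (esym nuE) (jordan_decomp nuPN mA).
    by rewrite !setIT /cadd/= !cscaleN1.
  have /fineK <- : m1 A \is a fin_num by exact: fin.
  have /fineK <- : m2 A \is a fin_num by exact: fin.
  have /fineK <- : jp A \is a fin_num by exact: fin_num_measure.
  have /fineK <- : jn A \is a fin_num by exact: fin_num_measure.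
  rewrite -!EFinN -!EFinD => -[E]; apply: congr1; lra.
have jpf : (jp setT < +oo)%E by rewrite ltey_eq fin_num_measure.
have jnf : (jn setT < +oo)%E by rewrite ltey_eq fin_num_measure.
have i1 := bounded_integrable m1f mf bf.
have i2 := bounded_integrable m2f mf bf.
have i1' := bounded_integrable jpf mf bf.
have i2' := bounded_integrable jnf mf bf.
have : \int[measure_add jp m2]_x f x = \int[measure_add jn m1]_x f x.
  congr fine; apply: eq_measure_integral => A mA _; exact: jpn.
by rewrite !Rintegral_measure_add//; exact: alg.
Qed.

End signed_integral.

(** * Averages over consecutive scales and C_0 functions *)

Section cesaro.
Context {R : realType} {Y : Type}.

(** The map sending [i] to [i + j + M] is injective and sends the counted indices into
    [[0, 2 M)]. *)
Lemma count_near (j : int) (M k : nat) :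
  (\sum_(i < k | (absz (i%:Z + j)%R < M)%N) 1 <= M.*2)%N.
Proof.
rewrite sum1_card cardE -(size_iota 0 M.*2).
rewrite -(size_map (fun i : 'I_k => absz (i%:Z + j + M%:Z)%R)).
have H (i : 'I_k) : i \in enum (fun i : 'I_k => (absz (i%:Z + j)%R < M)%N) ->
    (absz (i%:Z + j + M%:Z)%R)%:Z = i%:Z + j + M%:Z.
  rewrite mem_enum unfold_in; lia.
apply: uniq_leq_size.
  rewrite map_inj_in_uniq ?enum_uniq// => a b /H Ha /H Hb ab; apply: val_inj.
  move: Ha; rewrite ab Hb /=; lia.
move=> _ /mapP[i /[dup] /H Hi + ->]; rewrite mem_enum unfold_in mem_iota; lia.
Qed.

(* Whatever the shift [j], at most [2 M] indices [i] satisfy [|i + j| < M], so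
   the averages tend to [0] uniformly in [j] and [y]. *)
Lemma cesaro_vanishing (F : int -> Y -> R) (B : R) :
  (forall m y, `|F m y| <= B) ->
  (forall e : R, 0 < e -> exists M : nat,
    forall m y, (M <= absz m)%N -> `|F m y| <= e) ->
  forall (j : nat -> int) (y : nat -> Y),
  (fun k => k.+1%:R^-1 * \sum_(i < k.+1) F (i%:Z + j k) (y k)) @ \oo --> 0.
Proof.
move=> FB Fe j y; apply/cvgrPdist_le => e e0.
have [M HM] := Fe (e / 2) ltac:(by rewrite divr_gt0).
have B0 : 0 <= B by rewrite (le_trans _ (FB 0 (y 0%N))).
near=> k.
rewrite sub0r normrN normrM ger0_norm ?invr_ge0// mulrC ler_pdivrMr//.
rewrite (le_trans (ler_norm_sum _ _ _))//.
(* The near scales contribute at most [2 M B] to the sum, which is below [(e / 2) k] for large [k];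
   each far scale contributes at most [e / 2]. *)
rewrite (bigID (fun i : 'I_k.+1 => (absz (i%:Z + j k)%R < M)%N))/=.
have H1 : \sum_(i < k.+1 | (absz (i%:Z + j k)%R < M)%N) `|F (i%:Z + j k) (y k)| <=
    B * M.*2%:R.
  rewrite (@le_trans _ _ (\sum_(i < k.+1 | (absz (i%:Z + j k)%R < M)%N) B))//.
    by apply: ler_sum => i _; exact: FB.
  rewrite sumr_const -[leLHS]mulr_natr ler_wpM2l// ler_nat.
  by rewrite -sum1_card; exact: count_near.
have H2 : \sum_(i < k.+1 | ~~ (absz (i%:Z + j k)%R < M)%N) `|F (i%:Z + j k) (y k)| <=
    e / 2 * k.+1%:R.
  rewrite (@le_trans _ _ (\sum_(i < k.+1 | ~~ (absz (i%:Z + j k)%R < M)%N) e / 2))//.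
    by apply: ler_sum => i; rewrite -leqNgt => iM; exact: HM.
  rewrite sumr_const -[leLHS]mulr_natr ler_wpM2l//; first by rewrite divr_ge0// ltW.
  rewrite ler_nat.
  by rewrite (leq_trans (max_card _))// card_ord.
have H3 : B * M.*2%:R <= e / 2 * k.+1%:R.
  rewrite -ler_pdivrMl ?divr_gt0//.
  apply: (@le_trans _ _ k%:R); last by rewrite ler_nat.
  by near: k; exact: nbhs_infty_ger.
rewrite (le_trans (lerD H1 H2))//.
by rewrite [leRHS](_ : _ = e / 2 * k.+1%:R + e / 2 * k.+1%:R) ?lerD2r//; field.
Unshelve. all: by end_near. Qed.

End cesaro.

Section C0.
Context {R : realType} {n : nat}.
Implicit Types (phi : 'rV[R]_n -> R).

Lemma eucl_norm_ge_coord (x : 'rV[R]_n) i : `|x ord0 i| <= eucl_norm x.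
Proof.
rewrite /eucl_norm -sqrtr_sqr ler_wsqrtr// (bigD1 i)//= lerDl.
by apply: sumr_ge0 => k _; exact: sqr_ge0.
Qed.

(** Decay is expressed through a single coordinate because one large coordinate is what a point
    outside a cube or a slice provides. *)
Lemma C0_function_small phi : C0_function phi -> forall e : R, 0 < e ->
  exists2 r : R, 0 < r & forall (x : 'rV[R]_n) i, r < `|x ord0 i| -> `|phi x| < e.
Proof.
move=> [_ H] e /H[r Hr]; exists (`|r| + 1) => [|x i ri].
  by rewrite ltr_wpDl.
apply: Hr; rewrite (lt_le_trans _ (eucl_norm_ge_coord x i))//.
by rewrite (le_lt_trans _ ri)// (le_trans (ler_norm _))// lerDl.
Qed.

(** A [cube] is given by its lower corner; with side [r *+ 2] this corner yields [[-r, r]^n]. *)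
Definition centered r : 'rV[R]_n := const_mx (- r).

Lemma notin_cube_centered r (x : 'rV[R]_n) : ~ cube (r *+ 2) (centered r) x ->
  exists i, r < `|x ord0 i|.
Proof.
move=> /existsNP[i]; rewrite /= mxE in_itv/= => /negP H; exists i.
rewrite ltNge; apply: contra H; rewrite ler_norml => /andP[-> xr].
by rewrite mulr2n addKr.
Qed.

Lemma compact_bounded_fun phi (K : set 'rV[R]_n) : continuous phi -> compact K ->
  exists2 M : R, 0 <= M & forall x, K x -> `|phi x| <= M.
Proof.
move=> cphi cK.
have /compact_bounded[M [_ HM]] : compact (phi @` K).
  by apply: continuous_compact => //; exact: continuous_subspaceT.
exists (`|M| + 1) => [|x Kx]; first by rewrite addr_ge0.
by apply: HM; [rewrite (le_lt_trans (ler_norm _))// ltrDl|exists x].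
Qed.

Lemma C0_function_bounded phi :
  C0_function phi -> exists B : R, forall x, `|phi x| <= B.
Proof.
move=> phi0; have [r r0 Hr] := C0_function_small phi0 ltr01.
have [M M0 HM] := compact_bounded_fun phi0.1 (@compact_cube _ _ (r *+ 2) (centered r)).
exists (M + 1) => x.
have [/HM/le_trans->//|/notin_cube_centered[i /Hr/ltW/le_trans->//]] :=
  pselect (cube (r *+ 2) (centered r) x).
  by rewrite lerDl.
by rewrite lerDr.
Qed.

Lemma test_function_bounded phi :
  test_function phi -> exists B : R, forall x, `|phi x| <= B.
Proof.
move=> [sphi csupp]; have [M M0 HM] := compact_bounded_fun (sphi [::]).1 csupp.
exists M => x; have [->|px] := eqVneq (phi x) 0; first by rewrite normr0.
by apply: HM; exact: subset_closure.
Qed.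

(** Uniform continuity along one axis, which is what comparing two opposite faces takes: compactness
    handles a large cube, and outside it both values are below [e / 2]. *)
Lemma C0_function_unif_cont phi (i : 'I_n) : C0_function phi -> forall e : R, 0 < e ->
  exists2 d : R, 0 < d & forall x t, 0 <= t -> t < d ->
    `|phi x - phi (t *: delta_mx ord0 i + x)| <= e.
Proof.
move=> phi0 e e0.
have e20 : 0 < e / 2 by rewrite divr_gt0.
have [r r0 Hr] := C0_function_small phi0 e20.
(* The margin [1] absorbs the translation by [t < 1]: from outside [K], the translated point still
   has a coordinate beyond [r]. *)
pose K := cube ((r + 1) *+ 2) (centered (r + 1)).
have /compact_near_coveringP cK : compact K by exact: compact_cube.
have /nbhs_ballP[d /= d0 Hd] : \forall t \near (0 : R), K `<=`
    (fun x => `|phi x - phi (t *: delta_mx ord0 i + x)| <= e).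
  apply: (cK R (nbhs (0 : R))
    (fun t x => `|phi x - phi (t *: delta_mx ord0 i + x)| <= e)).
  move=> x Kx.
  pose g (z : 'rV[R]_n * R) := phi z.1 - phi (z.2 *: delta_mx ord0 i + z.1).
  have : g z @[z --> (x, 0 : R)] --> g (x, 0).
    apply: cvgB; first by apply: continuous_comp; [exact: cvg_fst|exact: phi0.1].
    apply: (@continuous_comp _ _ _
      (fun z : 'rV[R]_n * R => z.2 *: delta_mx ord0 i + z.1)).
      apply: cvgD; last exact: cvg_fst.
      apply: (@cvg_comp _ _ _ snd (fun t : R => t *: delta_mx ord0 i : 'rV[R]_n)).
        exact: cvg_snd.
      exact: scalel_continuous.
    exact: phi0.1.
  move=> /cvgrPdist_le /(_ e e0); apply: filterS => -[x' t].
  by rewrite {1}/g/= scale0r add0r subrr sub0r normrN.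
exists (Num.min d 1) => [|x t t0]; first by rewrite lt_min d0 ltr01.
rewrite lt_min => /andP[td t1].
have [Kx|/notin_cube_centered[j xj]] := pselect (K x).
  by apply: Hd => //; rewrite /ball/= sub0r normrN ger0_norm.
have H1 : `|phi x| < e / 2 by apply: (Hr _ j); lra.
have H2 : `|phi (t *: delta_mx ord0 i + x)| < e / 2.
  apply: (Hr _ j); rewrite !mxE eqxx/=.
  have tb : `|t * (j == i)%:R| <= t.
    by case: (j == i); rewrite ?mulr1 ?mulr0 ?normr0// ger0_norm.
  have := ler_normB (t * (j == i)%:R + x ord0 j) (t * (j == i)%:R).
  rewrite addrAC subrr add0r; lra.
by rewrite (le_trans (ler_normB _ _))//; lra.
Qed.

End C0.

(** * Face measures *)

Section insert_continuous.
Context {R : realType} {n : nat}.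
Implicit Types (i : 'I_n.+1).

Lemma continuous_insertr i (t : R) :
  continuous (fun v : 'rV[R]_n => insert i (t, v) : 'rV[R]_n.+1).
Proof.
move=> v A /nbhs_ballP[e /= e0 eA]; apply/nbhs_ballP; exists e => //= w.
rewrite ball_rV_box// => vw; apply: eA; rewrite ball_rV_box// => j.
case: (unliftP i j) => [k|] ->.
  by rewrite !insert_lift; exact: vw.
by rewrite !insert_same; exact: ballxx.
Qed.

Lemma continuous_comp_insertr i (t : R) (f : 'rV[R]_n.+1 -> R) : continuous f ->
  continuous (fun v : 'rV[R]_n => f (insert i (t, v))).
Proof.
by move=> cf v; apply: continuous_comp; [exact: continuous_insertr|exact: cf].
Qed.

End insert_continuous.

Section integral_mrestr.
Context d {T : measurableType d} {R : realType} (mu : {measure set T -> \bar R}).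

Lemma integral_mfrestr (D : set T) (mD : measurable D) (muD : (mu D < +oo)%E) f :
  (mfrestr mD muD).-integrable setT f ->
  (\int[mfrestr mD muD]_x f x = \int[mu]_(x in D) f x)%E.
Proof.
move=> fi; rewrite [LHS](negligible_integral (N := ~` D))//.
- rewrite setTD setCK; apply: eq_measure_integral => A mA AD.
  by rewrite /mfrestr /mrestr/=; congr (mu _); exact/setIidPl.
- exact: measurableC.
- by rewrite [LHS](_ : _ = mu (~` D `&` D))// setICl measure0.
Qed.

End integral_mrestr.

Section integral_cube.
Context {R : realType} {n : nat}.
Implicit Types (f : 'rV[R]_n -> R) (l : R) (y : 'rV[R]_n).
Let mu := @lebesgue_rV R n.

Lemma norm_Rintegral_cube_le f l y c : 0 <= l -> continuous f ->
  (forall x, `|f x| <= c) -> `|\int[mu]_(x in cube l y) f x| <= c * l ^+ n.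
Proof.
move=> l0 cf fc.
have fi := continuous_integrable_cube y l0 cf.
rewrite (le_trans (le_normr_Rintegral _ fi))//; first exact: measurable_cube.
have -> : l ^+ n = fine (mu (cube l y)).
  by have mc : mu (cube l y) = (l ^+ n)%:E := lebesgue_cube y l0; rewrite mc.
rewrite -Rintegral_cst; last exact: measurable_cube.
apply: le_Rintegral => //; first exact: measurable_cube.
- exact: integrable_norm.
- by apply: (@continuous_integrable_cube _ _ (fun=> c)) => //; exact: cst_continuous.
Qed.

End integral_cube.

Section face.
Context {R : realType}.

(* The image under [g[m, y]] of the indicator of the unit cube is [weight n m]
   times the indicator of [cube (side m) y]; by [weight_side], each face of this
   cube then carries mass [1]. *)
Definition side (m : int) : R := 2 ^ (- m).

Definition weight (n : nat) (m : int) : R := 2 ^ (n%:Z * m).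

Lemma side_gt0 m : 0 < side m.
Proof. exact: exprz_gt0. Qed.

Lemma side_ge0 m : 0 <= side m. Proof. exact/ltW/side_gt0. Qed.

Lemma weight_ge0 n m : 0 <= weight n m.
Proof. exact/ltW/exprz_gt0. Qed.

Lemma weight_side n m : weight n m * side m ^+ n = 1.
Proof.
rewrite /weight /side exprnP exprz_exp -expfzDr//.
by rewrite (_ : _ + _ = 0) ?expr0z//; lia.
Qed.

Section functional.
Context {n : nat}.
Variable i : 'I_n.+1.
Implicit Types (y : 'rV[R]_n.+1) (f : 'rV[R]_n.+1 -> R).

Definition slab (m : int) y : set 'rV[R]_n := cube (side m) (col' i y).

(* pairing of [f] with the i-th derivative of [weight n m] times the
   indicator of [cube (side m) y] *)
Definition face (m : int) y f : R := weight n m *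
  \int[@lebesgue_rV R n]_(v in slab m y)
    (f (insert i (y ord0 i, v)) - f (insert i (y ord0 i + side m, v))).

Lemma continuous_section_diff (a b : R) f : continuous f ->
  continuous (fun v : 'rV[R]_n => f (insert i (a, v)) - f (insert i (b, v))).
Proof.
move=> cf v.
exact: (continuousB (@continuous_comp_insertr _ _ i a f cf v)
  (@continuous_comp_insertr _ _ i b f cf v)).
Qed.

(** The minus sign is that of distributional derivatives; this is why [face] subtracts the upper
    face from the lower one. *)
Lemma Rintegral_peak_partial m y f : continuous f ->
  (forall x, derivable f x (delta_mx ord0 i)) -> continuous (partial i f) ->
  weight n m * \int[@lebesgue_rV R n.+1]_(x in cube (side m) y) partial i f x =
  - face m y f.
Proof.
move=> cf df cdf; rewrite /Rintegral integral_partial_cube//; last exact: side_gt0.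
rewrite /face -mulrN; congr (_ * _).
rewrite -mulN1r -RintegralZl//; first last.
- apply: continuous_integrable_cube; first exact: side_ge0.
  exact: continuous_section_diff.
- exact: measurable_cube.
by congr fine; apply: eq_integral => v _; congr EFin; rewrite mulN1r opprB.
Qed.

(** By [weight_side] the weight cancels the area of a face, so the bound depends on neither scale
    nor position. *)
Lemma norm_face_le m y f B : continuous f -> (forall x, `|f x| <= B) ->
  `|face m y f| <= B *+ 2.
Proof.
move=> cf fB; rewrite /face normrM ger0_norm ?weight_ge0//.
rewrite -[leRHS]mul1r -(weight_side n m) -mulrA ler_wpM2l ?weight_ge0//.
rewrite mulrC norm_Rintegral_cube_le ?side_ge0//.
  exact: continuous_section_diff.
by move=> v; rewrite (le_trans (ler_normB _ _))// mulr2n lerD.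
Qed.

(** The measure is Lebesgue measure on the slab pushed forward to the hyperplane where coordinate
    [i] equals [a]. Integrability is included so that the two faces can be separated by
    linearity. *)
Lemma signed_integral_section (a : R) m y :
  exists m1 : {measure set 'rV[R]_n.+1 -> \bar R},
   (m1 setT < +oo)%E /\
   forall f, measurable_fun setT f -> (exists B : R, forall x, `|f x| <= B) ->
    (@lebesgue_rV R n).-integrable (slab m y) (fun v => (f (insert i (a, v)))%:E) /\
    \int[@lebesgue_rV R n]_(v in slab m y) f (insert i (a, v)) = \int[m1]_x f x.
Proof.
have mQ : measurable (slab m y) by exact: measurable_cube.
have Qoo : (@lebesgue_rV R n (slab m y) < +oo)%E.
  by rewrite [ltLHS]lebesgue_cube ?ltry// side_ge0.
have mh : measurable_fun [set: 'rV[R]_n] (fun v => insert i (a, v) : 'rV[R]_n.+1).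
  apply: (@measurableT_comp _ _ _ _ _ _ (insert i) _ (pair a)).
    exact: measurable_insert.
  exact: measurable_pair1.
pose mu' := mfrestr mQ Qoo.
pose m1 := measure_function_pushforward__canonical__measure_function_Measure mu' mh.
have mu'oo : (mu' setT < +oo)%E by rewrite /mu' /mfrestr /mrestr/= setTI.
exists m1; split; first by rewrite /m1/= /pushforward preimage_setT.
move=> f mf [B fB].
have mfh : measurable_fun setT (f \o fun v => insert i (a, v)).
  exact: measurableT_comp.
have fhi : mu'.-integrable setT (EFin \o (f \o fun v => insert i (a, v))).
  by apply: bounded_integrable => //; exists B => x /=.
split.
  apply: (@measurable_bounded_integrable _ _ _ _ (f \o fun v => insert i (a, v))) => //.
    exact: measurable_funTS.
  exists B; split => [|N BN v _ /=]; first exact: num_real.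
  by rewrite (le_trans (fB _))// ltW.
rewrite /Rintegral /m1 integral_pushforward//=.
- by rewrite preimage_setT (integral_mfrestr fhi).
- exact/measurable_EFinP.
Qed.

Lemma signed_integral_face m y : signed_integral (face m y).
Proof.
rewrite /face; apply: signed_integralZ; first exact: weight_ge0.
have [m1 [m1f H1]] := signed_integral_section (y ord0 i) m y.
have [m2 [m2f H2]] := signed_integral_section (y ord0 i + side m) m y.
exists m1, m2; split => // f mf bf.
have [i1 <-] := H1 _ mf bf; have [i2 <-] := H2 _ mf bf.
by rewrite -RintegralB//; exact: measurable_cube.
Qed.

End functional.

End face.

(** * Decay of the face functionals away from the unit scale *)

Section face_vanishing.
Context {R : realType} {n : nat}.
Variable i : 'I_n.+2.
Implicit Types (f : 'rV[R]_n.+2 -> R).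
Let mu := @lebesgue_rV R n.+1.

(** Contains every point of the face whose first coordinate is at most [r] in absolute value. For
    fixed [r], its volume has one power of [l] less than that of the face. *)
Definition slice (r l : R) (y : 'rV[R]_n.+1) : set 'rV[R]_n.+1 :=
  box (fun j => if j == ord0 then `[- r, r]%classic
                else `[y ord0 j, y ord0 j + l]%classic).

Lemma measurable_slice r l y : measurable (slice r l y).
Proof. by apply: measurable_box => j; case: ifP => _; exact: measurable_itv. Qed.

Lemma lebesgue_slice r l y : 0 < r -> 0 < l ->
  mu (slice r l y) = (r *+ 2 * l ^+ n)%:E.
Proof.
move=> r0 l0; rewrite [LHS]lebesgue_box; last first.
  by move=> j; case: ifP => _; exact: measurable_itv.
rewrite big_ord_recl eqxx EFinM; congr (_ * _)%E.
  by rewrite lebesgue_measure_itv/= lte_fin gtrN// -EFinD opprK mulr2n.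
rewrite (eq_bigr (fun=> l%:E)) => [|j _].
  by rewrite prodEFin prodr_const card_ord.
by rewrite lebesgue_measure_itv/= lte_fin ltrDl l0 -EFinD addrAC subrr add0r.
Qed.

Lemma norm_Rintegral_section_le f (a r l e B : R) (y : 'rV[R]_n.+1) :
  continuous f -> 0 < r -> 0 < l -> 0 <= e ->
  (forall (x : 'rV[R]_n.+2) j, r < `|x ord0 j| -> `|f x| <= e) ->
  (forall x, `|f x| <= B) ->
  `|\int[mu]_(v in cube l y) f (insert i (a, v))| <=
    e * l ^+ n.+1 + B * (r *+ 2 * l ^+ n).
Proof.
move=> cf r0 l0 e0 fe fB.
have B0 : 0 <= B by rewrite (le_trans _ (fB 0)).
have cfa := @continuous_comp_insertr _ _ i a f cf.
have fi := continuous_integrable_cube y (ltW l0) cfa.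
have mc := measurable_cube l y.
have muc : mu (cube l y) = (l ^+ n.+1)%:E := lebesgue_cube y (ltW l0).
have mus := lebesgue_slice y r0 l0.
have ci (c : R) : mu.-integrable (cube l y) (EFin \o fun=> c).
  apply: (@continuous_integrable_cube _ _ (fun=> c)); first exact: ltW.
  exact: cst_continuous.
have ii : mu.-integrable (cube l y) (EFin \o \1_(slice r l y)).
  apply: measurable_bounded_integrable => //.
  - by rewrite [ltLHS]muc ltry.
  - by apply: measurable_funTS; apply: measurable_indic; exact: measurable_slice.
  - exists 1; split => [|M M1 x _]; first exact: num_real.
    rewrite /= indicE; case: (_ \in _); rewrite ?normr1 ?normr0 ltW//.
    by rewrite (lt_trans _ M1).
have Bii : mu.-integrable (cube l y) (EFin \o (fun v => B * \1_(slice r l y) v)).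
  by apply: eq_integrable (integrableZl mc B ii) => // x _; rewrite /= EFinM.
rewrite (le_trans (le_normr_Rintegral mc fi))//.
(* Off the slice the first coordinate of the face, which is coordinate [lift i ord0] of the space,
   exceeds [r], so [f] is at most [e] there; on the slice only the bound [B] is used. *)
rewrite (@le_trans _ _ (\int[mu]_(v in cube l y) (e + B * \1_(slice r l y) v)))//.
  apply: le_Rintegral => //.
  - exact: integrable_norm.
  - exact: (integrableD _ (ci e) Bii).
  - move=> v yv; rewrite indicE; have [_|/negP vS] := boolP (v \in _).
      by rewrite mulr1 (le_trans (fB _))// lerDr.
    rewrite mulr0 addr0 (fe _ (lift i ord0))// insert_lift /=.
    rewrite ltNge; apply/negP => vr; apply: vS; apply/mem_set => j.
    case: ifPn => [/eqP ->|_]; last exact: yv.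
    by rewrite /= in_itv/= -ler_norml.
rewrite RintegralD// Rintegral_cst//; apply: lerD.
  by suff : e * fine (mu (cube l y)) <= e * l ^+ n.+1 by []; rewrite muc.
rewrite RintegralZl// ler_wpM2l// /Rintegral.
rewrite integral_indic//; last exact: measurable_slice.
suff : fine (mu (slice r l y `&` cube l y)) <= r *+ 2 * l ^+ n by [].
have H : (mu (slice r l y `&` cube l y) <= (r *+ 2 * l ^+ n)%:E)%E.
  rewrite -mus le_measure// ?inE//; last exact: measurable_slice.
  by apply: measurableI => //; exact: measurable_slice.
rewrite -lee_fin fineK// ge0_fin_numE//.
by rewrite (le_lt_trans H)// ltry.
Qed.

(* On small cubes the two faces are close and [f] is uniformly continuous; the
   faces of large cubes have dimension [n.+1 > 0], and the mean of a function
   vanishing at infinity over them is small. *)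
Lemma face_vanishing f : C0_function f -> forall e : R, 0 < e ->
  exists M : nat, forall m (y : 'rV[R]_n.+2), (M <= absz m)%N -> `|face i m y f| <= e.
Proof.
move=> f0 e e0; have cf := f0.1.
have [B fB] := C0_function_bounded f0.
have B0 : 0 <= B by rewrite (le_trans _ (fB 0)).
have [d d0 Hd] := C0_function_unif_cont i f0 e0.
have e40 : 0 < e / 4 by rewrite divr_gt0.
have [r r0 Hr] := C0_function_small f0 e40.
have pow2 (x : R) : exists M : nat, x <= 2 ^+ M.
  exists (Num.truncn `|x|).+1; rewrite (le_trans (ler_norm _))//.
  rewrite (le_trans (ltW (truncnS_gt _)))//.
  by rewrite -natrX ler_nat ltnW// ltn_expl.
(* For [m >= 0], [M1] forces the side below [d], the [+ 1] making this strict. For [m < 0], [M2]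
   forces the side above [8 B r / e], so that the slice term [4 B r / side m] obtained at the end is
   at most [e / 2]. *)
have [M1 HM1] := pow2 (d^-1 + 1); have [M2 HM2] := pow2 (8 * B * r / e).
exists (maxn M1 M2) => m y; rewrite geq_max => /andP[mM1 mM2].
have [m0|m0] := leP 0 m.
  have ld : side m < d.
    rewrite /side -invr_expz invf_plt ?posrE ?exprz_gt0//.
    rewrite (@lt_le_trans _ _ (d^-1 + 1)) ?ltrDl// (le_trans HM1)//.
    rewrite (_ : m = (absz m)%:Z) -?exprnP; last lia.
    by rewrite ler_eXn2l// ltr1n.
  rewrite /face normrM ger0_norm ?weight_ge0//.
  rewrite -[leRHS]mul1r -(weight_side n.+1 m) -mulrA ler_wpM2l ?weight_ge0//.
  rewrite mulrC norm_Rintegral_cube_le ?side_ge0//.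
    exact: continuous_section_diff.
  by move=> v; rewrite insertD; apply: Hd => //; exact: side_ge0.
have lL : 8 * B * r / e <= side m.
  rewrite (le_trans HM2)// /side (_ : - m = (absz m)%:Z) -?exprnP; last lia.
  by rewrite ler_eXn2l// ltr1n.
have l0 := @side_gt0 R m.
have H a := norm_Rintegral_section_le a (col' i y) cf r0 l0 (ltW e40)
  (fun x j H => ltW (Hr x j H)) fB.
rewrite /face RintegralB//; first last.
- by apply: continuous_integrable_cube; [exact: ltW|exact: continuous_comp_insertr].
- by apply: continuous_integrable_cube; [exact: ltW|exact: continuous_comp_insertr].
- exact: measurable_cube.
rewrite normrM ger0_norm ?weight_ge0//.
rewrite (@le_trans _ _ (weight n.+1 m *
    ((e / 4 * side m ^+ n.+1 + B * (r *+ 2 * side m ^+ n)) *+ 2)))//.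
  rewrite ler_wpM2l ?weight_ge0// (le_trans (ler_normB _ _))// mulr2n.
  by apply: lerD; exact: H.
have W : weight n.+1 m * (side m * side m ^+ n) = 1 :> R.
  by rewrite -exprS weight_side.
have E : weight n.+1 m * side m ^+ n = (side m)^-1 :> R.
  by apply: (mulfI (lt0r_neq0 l0)); rewrite mulrCA W divff// lt0r_neq0.
have -> : weight n.+1 m *
    ((e / 4 * side m ^+ n.+1 + B * (r *+ 2 * side m ^+ n)) *+ 2) =
  e / 2 * (weight n.+1 m * (side m * side m ^+ n)) +
  4 * B * r * (weight n.+1 m * side m ^+ n) by rewrite exprS; field.
rewrite W E mulr1.
have : 4 * B * r / side m <= e / 2.
  rewrite ler_pdivrMr//; move: lL; rewrite ler_pdivrMr//; lra.
lra.
Qed.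

End face_vanishing.

(** * Averages of rescaled cubes *)

Section Rintegral_sum.
Context d {T : measurableType d} {R : realType} (mu : {measure set T -> \bar R}).
Context {D : set T} (mD : measurable D).

Lemma integrable_sumr (I : Type) (s : seq I) (f : I -> T -> R) :
  (forall i, mu.-integrable D (EFin \o f i)) ->
  mu.-integrable D (EFin \o (fun x => \sum_(i <- s) f i x)).
Proof.
move=> fi; rewrite (_ : _ \o _ = fun x => (\sum_(i <- s) (f i x)%:E)%E).
  by apply: integrable_sum => // i _; exact: fi.
by apply/funext => x; rewrite /= sumEFin.
Qed.

Lemma Rintegral_sum (I : Type) (s : seq I) (f : I -> T -> R) :
  (forall i, mu.-integrable D (EFin \o f i)) ->
  \int[mu]_(x in D) (\sum_(i <- s) f i x) = \sum_(i <- s) \int[mu]_(x in D) f i x.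
Proof.
move=> fi; rewrite /Rintegral; under eq_integral do rewrite -sumEFin.
rewrite integral_sum// (eq_bigr (fun i => (\int[mu]_(x in D) f i x)%:E)).
  by rewrite sumEFin.
by move=> i _; rewrite /Rintegral fineK//; exact: (integrable_fin_num mD (fi i)).
Qed.

End Rintegral_sum.

Lemma measurable_superlevel d (T : measurableType d) (R : realType)
    (f : T -> R) (M : R) :
  measurable_fun setT f -> measurable [set x | M < `|f x|].
Proof.
move=> mf; rewrite (_ : mkset _ =
    setT `&` (fun x => `|f x|) @^-1` `]M, +oo[%classic).
  have mn : measurable_fun setT (fun x => `|f x|) by exact: measurableT_comp.
  exact: mn.
by apply/seteqP; split => x /=; rewrite in_itv/= andbT; [|move=> []].
Qed.

Section stair.
Context {R : realType} {n : nat}.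
Let mu := @lebesgue_rV R n.+1.
Implicit Types (y : 'rV[R]_n.+1) (g : 'rV[R]_n.+1 -> R) (j m : int) (k : nat).

Definition peak m y : 'rV[R]_n.+1 -> R :=
  fun x => weight n m * \1_(cube (side m) y) x.

(** The sequence of the theorem is [stair k 0 0]; the parameters [j] and [y] make the family contain
    its images under the group. All cubes share the corner [y], hence are nested. *)
Definition stair k j y : 'rV[R]_n.+1 -> R :=
  fun x => k.+1%:R^-1 * \sum_(i < k.+1) peak (i%:Z + j) y x.

Lemma in_cube_dilation m j y x :
  cube (side m) 0 (2 ^ j *: (x - y)) <-> cube (side (m + j)) y x.
Proof.
have H i : (0 <= 2 ^ j * (x ord0 i - y ord0 i) <= 0 + side m) =
           (y ord0 i <= x ord0 i <= y ord0 i + side (m + j)).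
  rewrite pmulr_rge0 ?exprz_gt0// subr_ge0 add0r; congr (_ && _).
  rewrite -lerBlDl -[RHS](@ler_pM2l _ (2 ^ j)) ?exprz_gt0//; congr (_ <= _).
  by rewrite /side -expfzDr//; congr (_ ^ _); lia.
split=> Q i; have := Q i; rewrite /= !in_itv/= !mxE.
  by rewrite H.
by rewrite -H.
Qed.

(** Weights are multiplicative in the scale, so the prefactor of the dilation adds [j] to each
    exponent, matching the change of scale of the cubes. *)
Lemma dilation_stair k j y : dilation j y (stair k 0 0) = stair k j y.
Proof.
apply/funext => x; rewrite /dilation /stair mulrCA; congr (_ * _).
rewrite mulr_sumr; apply: eq_bigr => i _; rewrite /peak addr0 mulrA.
congr (_ * _).
  by rewrite /weight -expfzDr// mulrDr addrC.
rewrite !indicE; congr ((nat_of_bool _)%:R).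
by apply/idP/idP => /set_mem/in_cube_dilation/mem_set.
Qed.

Lemma peak_ge0 m y x : 0 <= peak m y x.
Proof. by rewrite /peak mulr_ge0 ?weight_ge0. Qed.

Lemma stair_ge0 k j y x : 0 <= stair k j y x.
Proof.
by rewrite /stair mulr_ge0 ?invr_ge0// sumr_ge0// => i _; exact: peak_ge0.
Qed.

Lemma measurable_peak m y : measurable_fun setT (peak m y).
Proof.
apply: measurable_funM => //; apply: measurable_indic; exact: measurable_cube.
Qed.

Lemma measurable_stair k j y : measurable_fun setT (stair k j y).
Proof.
apply: measurable_funM => //.
by apply: measurable_sum => i; exact: measurable_peak.
Qed.

(** Turns integrals against a peak into integrals over a cube, where the divergence theorem
    applies. *)
Lemma peakM_restrict m y g :
  (fun x => peak m y x * g x) = (fun x => weight n m * (g \_ (cube (side m) y)) x).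
Proof.
apply/funext => x; rewrite /peak -mulrA patchE indicE.
by case: (_ \in _); rewrite ?mul1r ?mul0r.
Qed.

Let restrict_integrable m y g : continuous g ->
  mu.-integrable setT (EFin \o (g \_ (cube (side m) y))).
Proof.
move=> cg; rewrite -restrict_EFin.
apply: (integrable_mkcond _ (measurable_cube (side m) y)).1.
exact: (continuous_integrable_cube y (side_ge0 m)).
Qed.

Lemma integrable_peakM m y g : continuous g ->
  mu.-integrable setT (EFin \o (fun x => peak m y x * g x)).
Proof.
move=> cg; rewrite peakM_restrict.
apply: eq_integrable (integrableZl measurableT (weight n m)
  (restrict_integrable m y cg)) => //.
Qed.

Lemma Rintegral_peakM m y g : continuous g ->
  \int[mu]_x (peak m y x * g x) = weight n m * \int[mu]_(x in cube (side m) y) g x.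
Proof.
move=> cg; rewrite peakM_restrict RintegralZl//; last exact: restrict_integrable.
by rewrite -Rintegral_mkcond.
Qed.

Lemma stairM k j y g : (fun x => stair k j y x * g x) =
  (fun x => k.+1%:R^-1 * \sum_(i < k.+1) (peak (i%:Z + j) y x * g x)).
Proof. by apply/funext => x; rewrite /stair -mulrA mulr_suml. Qed.

Let sum_integrable k j y g : continuous g ->
  mu.-integrable setT (EFin \o (fun x => \sum_(i < k.+1) (peak (i%:Z + j) y x * g x))).
Proof.
by move=> cg; apply: integrable_sumr => // i; exact: integrable_peakM.
Qed.

Lemma integrable_stairM k j y g : continuous g ->
  mu.-integrable setT (EFin \o (fun x => stair k j y x * g x)).
Proof.
move=> cg; rewrite stairM.
apply: eq_integrable (integrableZl measurableT k.+1%:R^-1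
  (sum_integrable k j y cg)) => //.
Qed.

Lemma Rintegral_stairM k j y g : continuous g ->
  \int[mu]_x (stair k j y x * g x) = k.+1%:R^-1 *
    \sum_(i < k.+1) weight n (i%:Z + j) *
      \int[mu]_(x in cube (side (i%:Z + j)) y) g x.
Proof.
move=> cg; rewrite stairM RintegralZl//; last exact: sum_integrable.
rewrite Rintegral_sum//; last by move=> i; exact: integrable_peakM.
by congr (_ * _); apply: eq_bigr => i _; rewrite Rintegral_peakM.
Qed.

Lemma integrable_stair k j y : mu.-integrable setT (EFin \o stair k j y).
Proof.
have := @integrable_stairM k j y (fun=> 1) (@cst_continuous _ _ _).
by apply: eq_integrable => // x _; rewrite /= mulr1.
Qed.

Lemma integrable_peak m y : mu.-integrable setT (EFin \o peak m y).
Proof.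
have := @integrable_peakM m y (fun=> 1) (@cst_continuous _ _ _).
by apply: eq_integrable => // x _; rewrite /= mulr1.
Qed.

Lemma Rintegral_stair_partial k j y i g : continuous g ->
  (forall x, derivable g x (delta_mx ord0 i)) -> continuous (partial i g) ->
  \int[mu]_x (stair k j y x * partial i g x) =
  - (k.+1%:R^-1 * \sum_(l < k.+1) face i (l%:Z + j) y g).
Proof.
move=> cg dg cdg; rewrite Rintegral_stairM// -mulrN -sumrN; congr (_ * _).
by apply: eq_bigr => l _; rewrite Rintegral_peak_partial.
Qed.

(** The cubes are nested and the largest is the one of index [0]. *)
Lemma stair_support k j y x : stair k j y x != 0 -> cube (side j) y x.
Proof.
apply: contra_neqP => yx; rewrite /stair big1 ?mulr0// => i _.
rewrite /peak indicE memNset ?mulr0// => yxi; apply: yx => l.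
have := yxi l; rewrite /= !in_itv/= => /andP[-> /le_trans->]//.
by rewrite lerD2l /side ler_eXz2l ?ltr1n// lerN2 lerDr.
Qed.

Lemma stair_le k j y : exists C : R, forall x, stair k j y x <= C.
Proof.
exists (k.+1%:R^-1 * \sum_(i < k.+1) weight n (i%:Z + j)) => x.
rewrite /stair ler_wpM2l ?invr_ge0// ler_sum// => i _.
by rewrite /peak ler_piMr ?weight_ge0// indicE lern1; case: (_ \in _).
Qed.

Lemma BVdot_stair k j y : BVdot (stair k j y).
Proof.
have mc := measurable_cube (side j) y.
split.
- split; first exact: measurable_stair.
  move=> K cK; have := integrable_stair k j y.
  move=> /(integrableS measurableT (compact_rV_measurable cK) (@subsetT _ _)).
  by move=> /integrableP[].
- move=> M M0.
  apply: (@le_lt_trans _ _ (mu (cube (side j) y))).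
    apply: le_measure; rewrite ?inE//.
      by apply: measurable_superlevel; exact: measurable_stair.
    move=> x /= Mx; apply: (@stair_support k); rewrite -normr_gt0.
    exact: lt_trans Mx.
  by rewrite [ltLHS](lebesgue_cube y (side_ge0 j)) ltry.
(* Coordinates of [v] are bounded by [1], so each face pairing is at most [2]. Averaging over scales
   preserves this, and there are [n.+1] directions. *)
- apply: (@le_lt_trans _ _ (n.+1%:R * 2)%:E); last exact: ltry.
  apply: ge_ereal_sup => _ [v [tv v1] <-].
  have cv i : continuous (partial i (fun x => v x ord0 i)).
    by have := ((tv i).1 [:: i]).1.
  have cdv : continuous (div v) 
    by apply: continuous_big => //; exact: add_continuous.
  rewrite -[leLHS]fineK; last first.
    exact: (integrable_fin_num _ (integrable_stairM k j y cdv)).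
  rewrite lee_fin.
  suff : \int[mu]_x (stair k j y x * div v x) <= n.+1%:R * 2 by [].
  rewrite (eq_Rintegral mu
      (g := fun x => \sum_(i < n.+1)
        stair k j y x * partial i (fun z => v z ord0 i) x)).
    rewrite Rintegral_sum//; last by move=> i; exact: integrable_stairM.
    rewrite -[n.+1 in leRHS]card_ord mulrC mulr_natr -sumr_const ler_sum// => i _.
    have cvi : continuous (fun x => v x ord0 i) := ((tv i).1 [::]).1.
    rewrite Rintegral_stair_partial//; last by have := ((tv i).1 [::]).2 i.
    rewrite (le_trans (ler_norm _))// normrN normrM ger0_norm ?invr_ge0//.
    rewrite mulrC ler_pdivrMr// (le_trans (ler_norm_sum _ _ _))//.
    rewrite -[k.+1 in leRHS]card_ord mulr_natr -sumr_const ler_sum// => l _.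
    apply: (@norm_face_le R n i _ y _ 1 cvi) => x.
    by rewrite (le_trans (eucl_norm_ge_coord _ _)).
  by move=> x _; rewrite /div mulr_sumr.
Qed.

End stair.

(** * Weak convergence *)

Lemma BVdot0 (R : realType) n : BVdot (fun _ : 'rV[R]_n => 0).
Proof.
split.
- split; first exact: measurable_cst.
  by move=> K _; under eq_integral do rewrite normr0; rewrite integral0.
- move=> M M0; rewrite (_ : mkset _ = set0) ?measure0//.
  by apply/seteqP; split => // x; rewrite /= normr0 ltNge (ltW M0).
- apply: (@le_lt_trans _ _ 0%E) => //; apply: ge_ereal_sup => _ [v _ <-].
  by under eq_integral do rewrite mul0r; rewrite integral0.
Qed.

Lemma fine_le_measure d (T : measurableType d) (R : realType)
    (mu : {measure set T -> \bar R}) (A B : set T) :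
  measurable A -> measurable B -> A `<=` B -> (mu B < +oo)%E ->
  fine (mu A) <= fine (mu B).
Proof.
move=> mA mB AB Boo; have AB' : (mu A <= mu B)%E by apply: le_measure; rewrite ?inE.
apply: fine_le => //; rewrite ge0_fin_numE//.
exact: le_lt_trans Boo.
Qed.

Section weak_convergence.
Context {R : realType} {n : nat}.
Let mu := @lebesgue_rV R n.+2.
Implicit Types (y : 'rV[R]_n.+2) (j m : int) (k : nat).

Lemma lebesgue_compact_lty (K : set 'rV[R]_n.+2) : compact K -> (mu K < +oo)%E.
Proof.
move=> cK; have [M M0 HM] : exists2 M : R, 0 <= M & forall x, K x -> `|x| <= M.
  have /compact_bounded[M [_ HM]] := cK.
  exists (`|M| + 1) => [|x Kx]; first by rewrite addr_ge0.
  by apply: HM => //; rewrite (le_lt_trans (ler_norm _))// ltrDl.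
apply: (@le_lt_trans _ _ (mu (cube (M *+ 2) (centered M)))).
  apply: le_measure; rewrite ?inE.
  - exact: compact_rV_measurable.
  - exact: measurable_cube.
  - move=> x Kx; apply: contrapT => /notin_cube_centered[i].
    by rewrite ltNge (le_trans (coord_le_norm _ _) (HM _ Kx)).
by rewrite [ltLHS](lebesgue_cube (centered M) (mulrn_wge0 _ M0)) ltry.
Qed.

(** For [m >= 0] the whole peak has integral [side m], that is [2 ^- m]. For [m < 0] its height is
    at most [2 ^ m] and the volume is at most that of [K]. The factor [1 + mu K] covers both
    cases. *)
Lemma Rintegral_peak_compact (K : set 'rV[R]_n.+2) m y : compact K ->
  \int[mu]_(x in K) peak m y x <= (1 + fine (mu K)) * 2 ^- absz m.
Proof.
move=> cK; have mK := compact_rV_measurable cK.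
have mc := measurable_cube (side m) y.
have muK0 : 0 <= fine (mu K) by rewrite fine_ge0.
have muKf : mu K \is a fin_num by rewrite ge0_fin_numE// lebesgue_compact_lty.
have mui : mu (cube (side m) y `&` K) \is a fin_num.
  rewrite ge0_fin_numE//; apply: le_lt_trans (lebesgue_compact_lty cK).
  by apply: le_measure; rewrite ?inE//; exact: measurableI.
have -> : \int[mu]_(x in K) peak m y x =
    weight n.+1 m * fine (mu (cube (side m) y `&` K)).
  rewrite /peak RintegralZl//; first by rewrite /Rintegral integral_indic.
  apply: measurable_bounded_integrable => //.
  - exact: lebesgue_compact_lty.
  - exists 1; split => [|M M1 x _]; first exact: num_real.
    rewrite /= indicE; case: (_ \in _); rewrite ?normr1 ?normr0 ltW//.
    by rewrite (lt_trans _ M1).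
have [m0|m0] := leP 0 m.
  rewrite (@le_trans _ _ (weight n.+1 m * side m ^+ n.+2))//.
    rewrite ler_wpM2l ?weight_ge0// -lee_fin fineK//.
    rewrite -(lebesgue_cube y (side_ge0 m)); apply: le_measure; rewrite ?inE//.
    exact: measurableI.
  rewrite exprSr mulrA weight_side mul1r.
  rewrite (_ : side m = 2 ^- absz m); first by rewrite ler_peMl// lerDl.
  by rewrite /side -invr_expz exprnP; congr (_ ^ _)^-1; lia.
apply: (@le_trans _ _ (weight n.+1 m * fine (mu K))).
  apply: ler_wpM2l; first exact: weight_ge0.
  apply: fine_le_measure => //; first exact: measurableI.
  exact: lebesgue_compact_lty.
rewrite mulrC ler_pM ?weight_ge0//; first by rewrite lerDr.
rewrite /weight exprnN ler_eXz2l ?ltr1n//; nia.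
Qed.

Lemma cvg_L1loc_stair (j : nat -> int) (y : nat -> 'rV[R]_n.+2) :
  cvg_L1loc (fun k => stair k (j k) (y k)) (fun=> 0).
Proof.
move=> K cK; have mK := compact_rV_measurable cK.
have bi m z : mu.-integrable K (EFin \o peak m z).
  apply: integrableS (integrable_peak m z) => //.
pose F m z := \int[mu]_(x in K) peak m z x.
have E k : (\int[mu]_(x in K) `|stair k (j k) (y k) x - 0|%:E =
    (k.+1%:R^-1 * \sum_(i < k.+1) F (i%:Z + j k) (y k))%:E)%E.
  have si : mu.-integrable K (EFin \o stair k (j k) (y k)).
    by apply: integrableS (integrable_stair k (j k) (y k)).
  under eq_integral do rewrite subr0 ger0_norm ?stair_ge0//.
  rewrite -[LHS]fineK; last exact: integrable_fin_num.
  congr EFin; rewrite -/(Rintegral mu K (stair k (j k) (y k))) /stair.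
  rewrite RintegralZl//; last exact: integrable_sumr.
  by rewrite Rintegral_sum.
rewrite (_ : (fun k => _) = EFin \o (fun k =>
    k.+1%:R^-1 * \sum_(i < k.+1) F (i%:Z + j k) (y k))); last first.
  by apply/funext => k; exact: E.
have F0 m z : `|F m z| <= (1 + fine (mu K)) * 2 ^- absz m.
  rewrite ger0_norm; first exact: Rintegral_peak_compact.
  by apply: Rintegral_ge0 => x _; exact: peak_ge0.
have C0 : 0 < 1 + fine (mu K) by rewrite ltr_pwDl// fine_ge0.
apply: cvg_EFin; first exact: nearW.
apply: (@cesaro_vanishing _ _ F (1 + fine (mu K))).
  move=> m z; rewrite (le_trans (F0 m z))// ler_piMr//; first exact: ltW.
  by rewrite invf_le1 ?exprn_gt0// exprn_ege1// ler1n.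
(* The crude inequality [M < 2 ^ M] suffices here. *)
move=> e e0; exists (Num.truncn ((1 + fine (mu K)) / e)).+1 => m z mM.
rewrite (le_trans (F0 m z))// ler_pdivrMr ?exprn_gt0// mulrC -ler_pdivrMr//.
rewrite (le_trans (ltW (truncnS_gt _)))// (@le_trans _ _ (absz m)%:R)//.
  by rewrite ler_nat.
by rewrite -natrX ler_nat ltnW// ltn_expl.
Qed.

Lemma BVdot_weak_cvg_stair (j : nat -> int) (y : nat -> 'rV[R]_n.+2) :
  BVdot_weak_cvg (fun k => stair k (j k) (y k)) (fun=> 0).
Proof.
split.
- by move=> k; exact: BVdot_stair.
- exact: BVdot0.
- exact: cvg_L1loc_stair.
move=> i.
(* The [i]-th derivative of the [k]-th function. Its charge represents [L k] on all bounded
   measurable functions, hence on test functions and on [C_0] alike. *)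
pose L k f := k.+1%:R^-1 * \sum_(l < k.+1) face i (l%:Z + j k) (y k) f.
have HL k : signed_integral (L k).
  apply: signed_integralZ; first by rewrite invr_ge0.
  by apply: signed_integral_sum => l; exact: signed_integral_face.
pose nu_ k := projT1 (cid (signed_integral_charge (HL k))).
have nu_E k := projT2 (cid (signed_integral_charge (HL k))).
have [nu nuE] := signed_integral_charge
  (@signed_integral0 _ ('rV[R]_n.+2 : measurableType _) R).
exists nu_, nu; split.
- move=> k phi tphi; rewrite nu_E; last exact: test_function_bounded.
    rewrite Rintegral_stair_partial ?opprK//.
    + exact: (tphi.1 [::]).1.
    + by have := (tphi.1 [::]).2 i.
    + by have := (tphi.1 [:: i]).1.
  exact: continuous_rV_measurable (tphi.1 [::]).1.
- move=> phi tphi; rewrite nuE; last exact: test_function_bounded.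
    rewrite (eq_Rintegral mu (g := fun=> 0)) => [|x _]; last by rewrite mul0r.
    by rewrite Rintegral_cst// mul0r oppr0.
  exact: continuous_rV_measurable (tphi.1 [::]).1.
- move=> phi phi0; have mphi := continuous_rV_measurable phi0.1.
  have [B HB] := C0_function_bounded phi0.
  rewrite nuE//; last by exists B.
  rewrite (_ : (fun k => _) = fun k => L k phi); last first.
    by apply/funext => k; rewrite nu_E//; exists B.
  apply: (@cesaro_vanishing _ _ (fun m z => face i m z phi) (B *+ 2)).
    by move=> m z; exact: norm_face_le phi0.1 HB.
  exact: face_vanishing.
Qed.

End weak_convergence.

(** * Lorentz norms *)

Section integral_facts.
Local Open Scope ereal_scope.

(** The integral of a nonnegative function is a supremum over the simple functions below it, hence
    monotone without measurability; this allows comparisons with [decr_rearrangement] directly. *)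
Lemma ge0_le_integralW d (T : measurableType d) (R : realType)
    (mu : {measure set T -> \bar R}) (D : set T) (f g : T -> \bar R) :
  (forall x, D x -> 0 <= f x) -> (forall x, D x -> f x <= g x) ->
  \int[mu]_(x in D) f x <= \int[mu]_(x in D) g x.
Proof.
move=> f0 fg; have g0 x : D x -> 0 <= g x.
  by move=> Dx; rewrite (le_trans (f0 _ Dx))// fg.
rewrite !ge0_integralE//; apply: le_ereal_sup => _ [h hf <-]; exists h => // x.
by rewrite (le_trans (hf x))//; apply: lee_restrict.
Qed.

(** On segments [[e m, V]] increasing to []0, V]], the primitive [t ^ a / a] gives the uniform bound
    [V ^ a / a]; monotone convergence concludes. *)
Lemma integral_powR_lty (R : realType) (a V : R) : (0 < a)%R -> (0 < V)%R ->
  \int[@lebesgue_measure R]_(t in `]0%R, V]) (t `^ (a - 1))%:E < +oo.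
Proof.
move=> a0 V0.
(* Starting at [m.+2] keeps the segment nondegenerate even for [m = 0]. *)
pose e m : R := (V / m.+2%:R)%R.
have e0 m : (0 < e m)%R by rewrite divr_gt0.
have eV m : (e m < V)%R by rewrite ltr_pdivrMr// ltr_pMr// ltr1n.
have -> : `]0%R, V]%classic = \bigcup_m `[e m, V]%classic.
  apply/seteqP; split => t /=; rewrite in_itv/=.
    move=> /andP[t0 tV]; exists (Num.truncn (V / t)) => //=.
    rewrite in_itv/= tV andbT ler_pdivrMr// mulrC -ler_pdivrMr//.
    by rewrite (le_trans (ltW (truncnS_gt _)))// ler_nat.
  by move=> [m _ /=]; rewrite in_itv/= => /andP[/(lt_le_trans (e0 m)) -> ->].
have mp : measurable_fun setT (fun t : R => (t `^ (a - 1))%:E).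
  by apply/measurable_EFinP; exact: measurable_powR.
have ndF : nondecreasing_seq (fun m => `[e m, V]%classic : set R).
  apply/nondecreasing_seqP => m; apply/subsetPset => t /=; rewrite !in_itv/=.
  move=> /andP[/(le_trans _) + ->]; rewrite andbT; apply.
  by rewrite ler_pM2l// lef_pV2 ?posrE// ler_nat.
have cv : \int[@lebesgue_measure R]_(t in `[e m, V]) (t `^ (a - 1))%:E @[m --> \oo] -->
    \int[@lebesgue_measure R]_(t in \bigcup_m `[e m, V]%classic) (t `^ (a - 1))%:E.
  apply: ge0_nondecreasing_set_cvg_integral => //.
  - by move=> m; exact: measurable_funTS.
  - by move=> m x _; rewrite lee_fin powR_ge0.
apply: (@le_lt_trans _ _ (a^-1 * V `^ a)%:E); last exact: ltry.
rewrite -(cvg_lim _ cv)//; apply: lime_le; first by apply/cvg_ex; eexists; exact: cv.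
apply: nearW => m.
pose F (t : R) : R := (a^-1 * t `^ a)%R.
have dF (t : R) : (0 < t)%R -> is_derive t 1%R F (t `^ (a - 1))%R.
  move=> t0; have := is_deriveZ a^-1 (is_derive1_powR a t0).
  by rewrite /GRing.scale/= mulrA mulVf ?mul1r// gt_eqF.
have cF (t : R) : (0 < t)%R -> {for t, continuous F}.
  by move=> t0; apply/differentiable_continuous/derivable1_diffP; have [] := dF t t0.
rewrite (@continuous_FTC2 _ _ F)//.
- rewrite -EFinB lee_fin /F gerBl; apply: mulr_ge0; first by rewrite invr_ge0 ltW.
  exact: powR_ge0.
- apply: continuous_in_subspaceT => t /set_mem/=; rewrite in_itv/= => /andP[et _].
  have t0 := lt_le_trans (e0 m) et.
  apply/differentiable_continuous/derivable1_diffP.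
  by have [] := is_derive1_powR (a - 1) t0.
- split.
  + move=> t; rewrite in_itv/= => /andP[et _].
    by have [] := dF t (lt_trans (e0 m) et).
  + exact/cvg_at_right_filter/cF.
  + exact/cvg_at_left_filter/cF.
- move=> t; rewrite in_itv/= => /andP[et _].
  by have [_ <-] := dF t (lt_trans (e0 m) et); rewrite derive1E.
Qed.

End integral_facts.

Section Lorentz.
Context {R : realType} {n : nat}.
Let mu := @lebesgue_rV R n.+1.
Let p : R := n.+1%:R / n%:R.
Local Open Scope ereal_scope.
Implicit Types (u : 'rV[R]_n.+1 -> R).

Lemma decr_rearrangement_ge0 u t : 0 <= decr_rearrangement u t.
Proof. by apply: ereal_sup_ubound; left. Qed.

Lemma Lorentz_normE u : Lorentz_norm p 1 u =
  \int[@lebesgue_measure R]_(t in `]0%R, +oo[)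
    (decr_rearrangement u t * (t `^ (n%:R / n.+1%:R) / t)%:E).
Proof.
rewrite /Lorentz_norm invr1 poweRe1; last first.
  apply: integral_ge0 => t; rewrite /= in_itv/= andbT => t0.
  by rewrite mule_ge0 ?poweR_ge0// lee_fin invr_ge0 ltW.
apply: eq_integral => t _; rewrite poweRe1.
  by rewrite -muleA -EFinM /p invf_div.
by rewrite mule_ge0 ?decr_rearrangement_ge0// lee_fin powR_ge0.
Qed.

(** The rearrangement is at most [C] and vanishes beyond [V], so the integrand is dominated by
    [C t ^ (a - 1)] on []0, V]], with [a = n / n.+1] positive. *)
Lemma Lorentz_norm_lty u C V : (0 < n)%N -> (0 <= C)%R -> (0 < V)%R ->
  (forall x, `|u x| <= C)%R ->
  (forall l, (0 < l)%R -> distribution_fun u l <= V%:E) ->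
  Lorentz_norm p 1 u < +oo.
Proof.
move=> n0 C0 V0 uC uV; rewrite Lorentz_normE.
set a : R := (n%:R / n.+1%:R)%R.
have a0 : (0 < a)%R by rewrite divr_gt0// ltr0n.
apply: (@le_lt_trans _ _ (\int[@lebesgue_measure R]_(t in `]0%R, +oo[)
    ((fun t => C%:E * (t `^ (a - 1))%:E) \_ `]0%R, V]) t)).
  apply: ge0_le_integralW => t /=; rewrite in_itv/= andbT => t0.
    by rewrite mule_ge0 ?decr_rearrangement_ge0// lee_fin divr_ge0 ?powR_ge0// ltW.
  have tt0 : (0 <= t `^ a / t)%R by rewrite divr_ge0 ?powR_ge0// ltW.
  rewrite patchE; case: ifPn => [|/negP tV].
    move=> _; rewrite (_ : t `^ (a - 1) = t `^ a / t)%R; last first.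
      by rewrite powRB ?powRr1 ?ltW// (gt_eqF t0) implybT.
    apply: lee_wpmul2r; first by rewrite lee_fin.
    apply: ge_ereal_sup => _ [->|[l [l0 tl] <-]]; first by rewrite lee_fin.
    rewrite lee_fin leNgt; apply/negP => Cl.
    move: tl; rewrite /distribution_fun (_ : mkset _ = set0).
      by rewrite measure0 lte_fin ltNge (ltW t0).
    apply/seteqP; split => // x /= /lt_le_trans /(_ (uC x)).
    by rewrite ltNge (ltW Cl).
  suff -> : decr_rearrangement u t = 0 by rewrite mul0e.
  apply/eqP; rewrite eq_le decr_rearrangement_ge0 andbT.
  apply: ge_ereal_sup => _ [->//|[l [l0 tl] <-]].
  exfalso; apply: tV; apply/mem_set; rewrite /= in_itv/= t0 /=.
  by rewrite -lee_fin (le_trans (ltW tl))// uV.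
rewrite -integral_mkcondr.
rewrite (_ : _ `&` _ = `]0%R, V]%classic); last first.
  apply/seteqP; split => t /=; rewrite !in_itv/= andbT; first by move=> [].
  by move=> /andP[-> ->].
rewrite ge0_integralZl_EFin//.
- by rewrite lte_mul_pinfty// ?lee_fin// integral_powR_lty.
- by move=> t _; rewrite lee_fin powR_ge0.
- by apply/measurable_EFinP; apply: measurable_funTS; exact: measurable_powR.
Qed.

(* [2 ^- (n.+1 * i)] is the volume of the [i]-th cube: on [itv i] the
   rearrangement is bounded below by the value of [u] on that cube. *)
Let itv i : set R := `]2 ^- (n.+1 * i.+1)%N, 2 ^- (n.+1 * i)%N[%classic.

Lemma Lorentz_norm_ge u k : (0 < n)%N ->
  (forall i x, (i < k.+1)%N -> cube (2 ^- i) 0 x ->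
    (k.+1%:R^-1 * 2 ^+ (n * i) <= u x)%R) ->
  measurable_fun setT u ->
  4^-1%:E <= Lorentz_norm p 1 u.
Proof.
move=> n0 uge mu_; rewrite Lorentz_normE.
set a : R := (n%:R / n.+1%:R)%R.
(* Half the height of [u] on the [i]-th cube, times the lower bound [2 ^ i] of [t ^ a / t] on
   [itv i]. *)
pose d (i : nat) : R := ((2 * k.+1%:R)^-1 * 2 ^+ (n.+1 * i))%R.
have d0 i : (0 <= d i)%R by rewrite mulr_ge0// ?invr_ge0 ?mulr_ge0.
have H (i : nat) t : (i < k.+1)%N -> itv i t ->
    (d i)%:E <= decr_rearrangement u t * (t `^ a / t)%:E.
  move=> ik; rewrite /itv /= in_itv/= => /andP[t1 t2].
  have t0 : (0 < t)%R by rewrite (lt_trans _ t1)// invr_gt0 exprn_gt0.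
  pose c : R := (k.+1%:R^-1 * 2 ^+ (n * i))%R.
  have c0 : (0 < c)%R by rewrite mulr_gt0// ?invr_gt0// exprn_gt0.
  (* The distribution function uses a strict inequality, while [u] is only known to be at least [c]
     on the cube; halving [c] gives the strictness. *)
  have H1 : (c / 2)%:E <= decr_rearrangement u t.
    apply: ereal_sup_ubound; right; exists (c / 2)%R => //.
    split; first by rewrite divr_gt0.
    apply: (@lt_le_trans _ _ (mu (cube (2 ^- i) 0))).
      rewrite [ltRHS](@lebesgue_cube _ _ (2 ^- i)) ?invr_ge0 ?exprn_ge0//.
      by rewrite lte_fin exprVn -exprM mulnC.
    apply: le_measure; rewrite ?inE.
    - exact: measurable_cube.
    - exact: measurable_superlevel.
    move=> x /(uge _ _ ik) cu /=; rewrite (lt_le_trans _ (ler_norm _))//.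
    by rewrite (lt_le_trans _ cu)// ltr_pdivrMr// ltr_pMr// ltr1n.
  (* With [t = s ^ n.+1] the quotient is [1 / s], and [t < 2 ^- (n.+1 * i)] gives [s <= 2 ^- i]. *)
  have H2 : (2 ^+ i <= t `^ a / t)%R.
    pose s := (t `^ n.+1%:R^-1)%R.
    have s0 : (0 < s)%R by rewrite powR_gt0.
    have ts : t = (s ^+ n.+1)%R.
      by rewrite -powR_mulrn ?ltW// -powRrM mulVf ?powRr1 ?ltW// pnatr_eq0.
    have -> : (t `^ a = s ^+ n)%R.
      by rewrite -powR_mulrn ?ltW// -powRrM /a mulrC.
    have s2 : (2 ^+ i * s <= 1)%R.
      rewrite mulrC -ler_pdivlMr ?exprn_gt0// mul1r leNgt; apply/negP => is_.
      move: t2; apply/negP; rewrite -leNgt ts mulnC exprM -exprVn ltW//.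
      by rewrite ltr_pXn2r// nnegrE ?invr_ge0 ?exprn_ge0// ltW.
    rewrite {1}ts ler_pdivlMr ?exprn_gt0// exprS mulrA ler_piMl//.
    by rewrite exprn_ge0// ltW.
  apply: (@le_trans _ _ ((c / 2)%:E * (2 ^+ i)%:E)).
    rewrite -EFinM lee_fin (_ : d i = c / 2 * 2 ^+ i)%R//.
    by rewrite /d /c mulSn exprD invfM; ring.
  by apply: lee_pmul; rewrite ?lee_fin ?exprn_ge0// divr_ge0// ltW.
have mitv i : measurable (itv i) by exact: measurable_itv.
(* The intervals are disjoint, so at most one term is nonzero at each [t] and [h] minorizes the
   integrand. *)
pose h (t : R) : \bar R := \sum_(i < k.+1) (d i)%:E * (\1_(itv i) t)%:E.
have itv_gt0 i t : itv i t -> (0 < t)%R.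
  rewrite /itv/= in_itv/= => /andP[+ _]; apply: lt_trans.
  by rewrite invr_gt0 exprn_gt0.
have itv_inj i j t : itv i t -> itv j t -> (i <= j)%N.
  rewrite /itv/= !in_itv/= => /andP[_ t1] /andP[t2 _]; rewrite leqNgt; apply/negP => ji.
  have := lt_trans t2 t1; rewrite ltf_pV2 ?posrE ?exprn_gt0//.
  by rewrite ltr_eXn2l ?ltr1n// ltn_pmul2l// ltnNge ji.
apply: (@le_trans _ _ (\int[@lebesgue_measure R]_(t in `]0%R, +oo[) h t)); last first.
  apply: ge0_le_integralW => t /=; rewrite in_itv/= andbT => t0.
    by apply: sume_ge0 => i _; rewrite mule_ge0// ?lee_fin.
  have [[i it]|tn] := pselect (exists i : 'I_k.+1, itv i t).
    rewrite /h (bigD1 i)//= indicE mem_set// mule1 big1 ?adde0; first exact: H.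
    move=> j /negP ji; rewrite indicE memNset ?mule0// => jt; apply: ji.
    by apply/eqP/val_inj/anti_leq; rewrite (itv_inj _ _ _ jt it) (itv_inj _ _ _ it jt).
  rewrite /h big1 => [|j _].
    rewrite mule_ge0 ?decr_rearrangement_ge0// lee_fin divr_ge0 ?powR_ge0//.
    exact: ltW.
  by rewrite indicE memNset ?mule0// => jt; apply: tn; exists j.
rewrite /h ge0_integral_sum//; first last.
- by move=> i t _; rewrite mule_ge0// ?lee_fin.
- move=> i; apply: measurable_funeM; apply/measurable_EFinP.
  by apply: measurable_funTS; apply: measurable_indic; exact: mitv.
rewrite (eq_bigr (fun i : 'I_k.+1 =>
    (d i * (2 ^- (n.+1 * i)%N - 2 ^- (n.+1 * i.+1)%N))%:E)).
  rewrite sumEFin lee_fin.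
  rewrite (@le_trans _ _ (\sum_(i < k.+1) (4 * k.+1%:R)^-1)%R)//.
    by rewrite sumr_const card_ord -[leRHS]mulr_natr invfM -mulrA mulVf// mulr1 lexx.
  apply: ler_sum => i _.
  rewrite /d; set q := (2 ^+ (n.+1 * i))%R.
  have q0 : (0 < q)%R by rewrite exprn_gt0.
  have -> : (2 ^- (n.+1 * i.+1) = q^-1 * 2 ^- n.+1 :> R)%R.
    by rewrite mulnSr exprD invfM.
  (* The ratio of consecutive volumes. Since [w <= 1/2], the interval has at least half the volume
     of its cube, whence [1 / (4 k.+1)] per scale. *)
  set w := (2 ^- n.+1)%R.
  have w2 : (w <= 2^-1)%R.
    by rewrite lef_pV2 ?posrE ?exprn_gt0// -[leLHS]expr1 ler_eXn2l ?ltr1n.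
  have K0 : (0 < k.+1%:R :> R)%R by [].
  move: (k.+1%:R)%R K0 => K K0.
  rewrite (_ : _ * (_ - _) = (2 * K)^-1 * (1 - w))%R; last first.
    by field; rewrite !gt_eqF.
  rewrite (_ : (4 * K)^-1 = (2 * K)^-1 * 2^-1)%R; last first.
    by field; rewrite gt_eqF.
  apply: ler_wpM2l; first by rewrite invr_ge0 mulr_ge0// ltW.
  lra.
move=> i _; rewrite ge0_integralZl_EFin//; last first.
  apply/measurable_EFinP; apply: measurable_funTS; apply: measurable_indic; exact: mitv.
rewrite integral_indic; [|exact: measurable_itv|exact: mitv].
rewrite (_ : itv i `&` _ = itv i); last first.
  by apply/setIidPl => t /itv_gt0; rewrite /= in_itv/= andbT.
have lI : @lebesgue_measure R (itv i) =
    (2 ^- (n.+1 * i)%N - 2 ^- (n.+1 * i.+1)%N)%:E.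
  rewrite /itv lebesgue_measure_itv/= lte_fin ltf_pV2 ?posrE ?exprn_gt0//.
  by rewrite ltr_eXn2l ?ltr1n// ltn_pmul2l// ltnSn EFinB.
suff : (d i)%:E * @lebesgue_measure R (itv i) =
  (d i * (2 ^- (n.+1 * i)%N - 2 ^- (n.+1 * i.+1)%N))%:E by [].
by rewrite lI EFinM.
Qed.

End Lorentz.

(** * Lorentz norms of the averages, and the theorem *)

Section stair_Lorentz.
Context {R : realType} {n : nat}.
Hypothesis n0 : (0 < n)%N.
Let p : R := n.+1%:R / n%:R.
Let u k : 'rV[R]_n.+1 -> R := stair k 0 0.

Lemma stair_Lorentz k : Lorentz p 1 (u k).
Proof.
split; first exact: measurable_stair.
have [C uC] := @stair_le R n k 0 0.
have C0 : 0 <= C by rewrite (le_trans _ (uC 0))// stair_ge0.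
apply: (@Lorentz_norm_lty R n _ C 1) => // [x|l l0].
  by rewrite ger0_norm; [exact: uC|exact: stair_ge0].
apply: (@le_trans _ _ (lebesgue_rV (cube (side 0) (0 : 'rV[R]_n.+1)))); last first.
  by rewrite lebesgue_cube ?side_ge0// /side oppr0 expr0z expr1n.
apply: le_measure; rewrite ?inE.
- by apply: measurable_superlevel; exact: measurable_stair.
- exact: measurable_cube.
- move=> x /= lx; apply: (@stair_support _ _ k); rewrite -normr_gt0.
  exact: lt_trans l0 lx.
Qed.

(** On the [i]-th cube the [i]-th term alone gives the required height, the others being
    nonnegative. *)
Lemma stair_Lorentz_norm_ge k : (4^-1%:E <= Lorentz_norm p 1 (u k))%E.
Proof.
apply: (Lorentz_norm_ge (k := k)) => //; last exact: measurable_stair.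
move=> i x ik xi; rewrite /u /stair ler_wpM2l ?invr_ge0//.
rewrite (bigD1 (Ordinal ik))//= -[leLHS]addr0 lerD//; last first.
  by apply: sumr_ge0 => j _; exact: peak_ge0.
have -> : peak (i%:Z + 0) (0 : 'rV[R]_n.+1) x = weight n i.
  by rewrite /peak addr0 indicE mem_set ?mulr1// /side -invr_expz.
by rewrite /weight -PoszM.
Qed.

End stair_Lorentz.

(** Membership in the Lorentz space is part of the conclusion, so the failure of convergence is not
    due to infinite norms. *)
Theorem mainTheorem3 (R : realType) (N : nat) (hN : (2 <= N)%N) :
  exists u : nat -> 'rV[R]_N -> R,
    [/\ forall k, BVdot (u k),
        forall k, Lorentz (N%:R / N.-1%:R) 1 (u k),
        forall (j : nat -> int) (y : nat -> 'rV[R]_N),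
          BVdot_weak_cvg (fun k => dilation (j k) (y k) (u k)) (fun=> 0)
      & ~ Lorentz_cvg (N%:R / N.-1%:R) 1 u (fun=> 0)].
Proof.
(* With [N = n.+2] the faces have positive dimension, as [face_vanishing] requires. *)
case: N hN => [|[|n]]// _; exists (fun k => stair k 0 0); split.
- by move=> k; exact: BVdot_stair.
- by move=> k; exact: stair_Lorentz.
- move=> j y; rewrite (_ : (fun k => _) = fun k => stair k (j k) (y k)).
    exact: BVdot_weak_cvg_stair.
  by apply/funext => k; exact: dilation_stair.
- rewrite /Lorentz_cvg => h.
  suff : (4^-1%:E <= (0 : \bar R))%E by rewrite lee_fin invr_le0 lern0.
  rewrite -(cvg_lim _ h)//; apply: lime_ge; first by apply/cvg_ex; eexists; exact: h.
  apply: nearW => k; under [X in Lorentz_norm _ _ X]funext do rewrite subr0.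
  exact: stair_Lorentz_norm_ge.
Qed.
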